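(* Let $\Pi_1=\Pi_2=\Pi_3=\Pi_{\rm st}(n)$ be the standard planar network of rank $n$, and let $w_i\in\mathbb T^{\Pi_i}$ ($i=1,2,3$) be weightings such that all components of the corresponding 6-tuple of tropical singular values are real, and such that $(\Pi_1,w_1)$, $(\Pi_2,w_2)$, $(\Pi_3,w_3)$, $(\Pi_1\circ\Pi_2,w_1\circ w_2)$, $(\Pi_2\circ\Pi_3,w_2\circ w_3)$ and $(\Pi_1\circ\Pi_2\circ\Pi_3,w_1\circ w_2\circ w_3)$ satisfy the multi-Gelfand-Zeitlin condition. Let $m_{i,j,k}=m_{i,j,k}(w_1,w_2,w_3)$. Then for all integers $i,j,k\ge0$ with $i+j+k\le n-2$, $$m_{i,j+1,k}+m_{i+1,j,k+1}=\max\{m_{i+1,j,k}+m_{i,j+1,k+1},\ m_{i+1,j+1,k}+m_{i,j,k+1}\}.$$ Furthermore, the values $m_{i,j,k}$ with $k=0$ or $i=0$ (the pair of faces $(\lambda,\mu,\rho)$ and $(\rho,\nu,\tau)$) completely determine all the other $m_{i,j,k}$; and likewise the values $m_{i,j,k}$ with $i+j+k=n$ or $j=0$ (the pair of faces $(\mu,\nu,\sigma)$ and $(\lambda,\sigma,\tau)$) completely determine all the other $m_{i,j,k}$. That is, if two such triples of weightings give the same values of $m$ on one of these two pairs of faces, they give the same values of $m$ on all of $\Delta^3(n)$.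
   Context: **Planar networks.** $\mathbb T=\mathbb R\cup\{-\infty\}$. A planar network of rank $n$ is a finite planar graph embedded in a strip $0\le x\le r$ with no vertical edges, oriented from left to right, with $n$ sources on $x=0$ and $n$ sinks on $x=r$, each labelled $1,\dots,n$ from bottom to top. A weighting is a map $w$ from edges to $\mathbb T$; $\mathbb T^\Pi$ is the set of weightings. Concatenation $\Pi_1\circ\Pi_2$ glues the $i$-th sink of $\Pi_1$ to the $i$-th source of $\Pi_2$; $w_1\circ w_2$ is the induced weighting. An $a$-multipath in $\Pi$ is a collection of $a$ pairwise vertex-disjoint oriented paths from sources to sinks. For $\underline\alpha=(\alpha_1,\dots,\alpha_k)\in\mathbb Z_{\ge0}^k$, an $\underline\alpha$-multipath in $\Pi_1\circ\dots\circ\Pi_k$ is a tuple $p=(p_1,\dots,p_k)$ of pairwise vertex-disjoint multipaths, $p_i$ being an $\alpha_i$-multipath in $\Pi_1\circ\dots\circ\Pi_i$ (starting at sources of $\Pi_1$, ending at sinks of $\Pi_i$). Its weight is the sum of the weights of all its edges. **The function $m$.** $\Delta^3(n)=\{(i,j,k)\in\mathbb Z_{\ge0}^3:i+j+k\le n\}$. For $\underline\alpha\in\Delta^3(n)$, $m_{\underline\alpha}(w_1,w_2,w_3)$ is the maximal weight of an $\underline\alpha$-multipath in $\Pi_1\circ\Pi_2\circ\Pi_3$ ($-\infty$ if there is none), and $m_{0,0,0}=0$. **Tropical singular values** $\lambda_1,\dots,\lambda_n$ of $(\Pi,w)$: $\lambda_1+\dots+\lambda_l$ is the maximal weight of an $l$-multipath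 in $\Pi$. The 6-tuple $(\lambda,\mu,\nu,\rho,\sigma,\tau)$ consists of the tropical singular values of $(\Pi_1,w_1)$, $(\Pi_2,w_2)$, $(\Pi_3,w_3)$, $(\Pi_1\circ\Pi_2,w_1\circ w_2)$, $(\Pi_2\circ\Pi_3,w_2\circ w_3)$, $(\Pi_1\circ\Pi_2\circ\Pi_3,w_1\circ w_2\circ w_3)$. **Multi-Gelfand-Zeitlin condition.** A weighting of a composite network $\Pi_1\circ\dots\circ\Pi_k$ satisfies it if for every $\underline\alpha\in\mathbb Z_{\ge0}^k$ with $\sum\alpha_i\le n$ there is an $\underline\alpha$-multipath of maximal weight (among $\underline\alpha$-multipaths) whose set of sources is $\{n-\sum\alpha_i+1,\dots,n\}$ and such that the set of sinks of $p_i$ is $\{1,\dots,\alpha_i\}$ for each $i$ (for a single network take $k=1$). **Standard network.** $\Pi_{\rm st}(n)$ consists of $n$ horizontal lines numbered $1,\dots,n$ from bottom to top (line $l$ joins source $l$ to sink $l$), and for each $1\le i<l\le n$ a slanted edge $a_{l,i}$ going (left to right) down from line $l$ to line $l-1$. On each line $l$ the attaching points are, from left to right: end of $a_{l+1,1}$, start of $a_{l,1}$, end of $a_{l+1,2}$, start of $a_{l,2}$, …, end of $a_{l+1,l-1}$, start of $a_{l,l-1}$, end of $a_{l+1,l}$ (for $l=n$ only the starts are present). *)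

(* Defs.v *)
From HB Require Import structures.
From mathcomp Require Import all_boot all_order all_algebra.
From mathcomp Require Import all_classical all_reals ereal.

Set Implicit Arguments.
Unset Strict Implicit.
Unset Printing Implicit Defensive.

Import Order.TTheory GRing.Theory Num.Theory.

Local Open Scope classical_set_scope.
Local Open Scope ereal_scope.
Local Open Scope nat_scope.

(* Labels are shifted by one: sources, sinks and lines are numbered 0, ..., n-1
   from bottom to top (the elements of 'I_n) instead of 1, ..., n. *)

(* The vertices of a network are its n sources, its inner vertices and its n
   sinks; edges go from left to right, so that an edge starts at a source
   ([inl]) or an inner vertex, and ends at an inner vertex or a sink ([inr]).
   The embedding in the strip is not recorded, as no definition below refers
   to it. *)
Record network (n : nat) := Network {
  inner : finType;
  edge : finType;
  tail : edge -> ('I_n + inner)%type;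
  head : edge -> (inner + 'I_n)%type
}.

(* The tropical numbers: real numbers and -oo. *)
Definition trop (R : realType) := {x : \bar R | x != +oo%E}.

Definition weighting (R : realType) (n : nat) (N : network n) :=
  edge N -> trop R.

(* The composite of N_0, ..., N_(k-1), as a graph: the boundary vertex (b, i) is
   source i of N_0 if b = 0, sink i of N_(k-1) if b = k, and otherwise the vertex
   obtained by gluing sink i of N_(b-1) to source i of N_b. *)
Definition cvertex (n k : nat) (N : 'I_k -> network n) :=
  ('I_k.+1 * 'I_n + {j : 'I_k & inner (N j)})%type.

Definition cedge (n k : nat) (N : 'I_k -> network n) :=
  {j : 'I_k & edge (N j)}.

Definition boundary (n k : nat) (N : 'I_k -> network n) (b : 'I_k.+1)
  (i : 'I_n) : cvertex N := inl (b, i).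

Definition inside (n k : nat) (N : 'I_k -> network n) (j : 'I_k)
  (v : inner (N j)) : cvertex N := inr (Tagged (fun j => inner (N j)) v).

Definition ctail (n k : nat) (N : 'I_k -> network n) (e : cedge N) : cvertex N :=
  match tail (tagged e) with
  | inl i => boundary N (widen_ord (leqnSn k) (tag e)) i
  | inr v => inside v
  end.

Definition chead (n k : nat) (N : 'I_k -> network n) (e : cedge N) : cvertex N :=
  match head (tagged e) with
  | inl v => inside v
  | inr i => boundary N (lift ord0 (tag e)) i
  end.

Definition cweight (R : realType) (n k : nat) (N : 'I_k -> network n)
  (w : forall j, weighting R (N j)) (e : cedge N) : \bar R :=
  sval (w (tag e) (tagged e)).

(* A path is given by the label of the source of N_0 where it starts and by the
   sequence of its edges. *)
Definition cpath (n k : nat) (N : 'I_k -> network n) :=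
  ('I_n * seq (cedge N))%type.

Fixpoint walk (n k : nat) (N : 'I_k -> network n) (v : cvertex N)
  (s : seq (cedge N)) : bool :=
  if s is e :: s' then (ctail e == v) && walk (chead e) s' else true.

Definition start (n k : nat) (N : 'I_k -> network n) (x : cpath N) : cvertex N :=
  boundary N ord0 x.1.

Definition finish (n k : nat) (N : 'I_k -> network n) (x : cpath N) : cvertex N :=
  last (start x) (map (@chead n k N) x.2).

Definition vertices (n k : nat) (N : 'I_k -> network n) (x : cpath N) :
  seq (cvertex N) := start x :: map (@chead n k N) x.2.

(* x is an oriented path in the composite of N_0, ..., N_i, from a source to a
   sink. *)
Definition is_path_upto (n k : nat) (N : 'I_k -> network n) (i : 'I_k)
  (x : cpath N) : Prop :=
  [/\ walk (start x) x.2,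
      all (fun e : cedge N => tag e <= i) x.2
    & exists t : 'I_n, finish x = boundary N (lift ord0 i) t].

(* p is an alpha-multipath; the disjointness of the paths is the absence of
   repetition in the list of all the vertices on all the paths. *)
Definition is_multipath (n k : nat) (N : 'I_k -> network n)
  (alpha : 'I_k -> nat) (p : 'I_k -> seq (cpath N)) : Prop :=
  [/\ forall i, size (p i) = alpha i,
      forall i x, x \in p i -> is_path_upto i x
    & uniq (flatten [seq vertices x | i <- enum 'I_k, x <- p i])].

Definition multipath_weight (R : realType) (n k : nat) (N : 'I_k -> network n)
  (w : forall j, weighting R (N j)) (p : 'I_k -> seq (cpath N)) : \bar R :=
  (\sum_(i < k) \sum_(x <- p i) \sum_(e <- x.2) cweight w e)%E.

(* There are finitely many paths without repeated vertices, so the supremum is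
   a maximum, except that it is -oo if there is no alpha-multipath. *)
Definition max_weight (R : realType) (n k : nat) (N : 'I_k -> network n)
  (w : forall j, weighting R (N j)) (alpha : 'I_k -> nat) : \bar R :=
  ereal_sup [set multipath_weight w p | p in [set p | is_multipath alpha p]].

(* An l-multipath of the whole composite is a (0, ..., 0, l)-multipath. *)
Definition only_last (k l : nat) (i : 'I_k) : nat := if i.+1 == k then l else 0.

Definition singular_values (R : realType) (n k : nat) (N : 'I_k -> network n)
  (w : forall j, weighting R (N j)) (lambda : 'I_n -> \bar R) : Prop :=
  forall l : nat, l <= n ->
    (\sum_(i < n | (i < l)%N) lambda i)%E = max_weight w (@only_last k l).

Definition real_singular_values (R : realType) (n k : nat)
  (N : 'I_k -> network n) (w : forall j, weighting R (N j)) : Prop :=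
  exists lambda : 'I_n -> R, singular_values w (fun i => (lambda i)%:E).

Definition multi_Gelfand_Zeitlin (R : realType) (n k : nat)
  (N : 'I_k -> network n) (w : forall j, weighting R (N j)) : Prop :=
  forall alpha : 'I_k -> nat, \sum_(i < k) alpha i <= n ->
  exists p : 'I_k -> seq (cpath N),
    [/\ is_multipath alpha p,
        multipath_weight w p = max_weight w alpha,
        forall s : 'I_n,
          (exists i, exists2 x, x \in p i & start x = boundary N ord0 s) <->
          n - \sum_(i < k) alpha i <= s
      & forall (i : 'I_k) (t : 'I_n),
          (exists2 x, x \in p i & finish x = boundary N (lift ord0 i) t) <->
          t < alpha i].

(* The slanted edge (l, i) goes down from line l to line l-1; in the numbering
   from 1 it is a_{l+1,i+1}. *)
Definition slanted (n : nat) := {a : 'I_n * 'I_n | a.2 < a.1}.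

Definition slant (n l i : nat) : option (slanted n) :=
  [pick a : slanted n | ((val a).1 == l :> nat) && ((val a).2 == i :> nat)].

(* The inner vertices of the standard network: [inl a] is the start (upper end)
   of the slanted edge a, and [inr a] is its end (lower end). *)
Definition attaching (n : nat) := (slanted n + slanted n)%type.

(* The attaching points on line l, from left to right: end of (l+1, 0), start of
   (l, 0), end of (l+1, 1), start of (l, 1), and so on; those for which there is
   no such slanted edge are left out. *)
Definition line_points (n l : nat) : seq (attaching n) :=
  pmap id (flatten [seq [:: omap inr (slant n l.+1 i); omap inl (slant n l i)]
                   | i <- iota 0 n]).

(* Edges: the slanted ones, and the horizontal segments (l, r), where r is the
   position of the segment on line l, counted from the left. *)
Definition standard_edge (n : nat) :=
  (slanted n + {l : 'I_n & 'I_(size (line_points n l)).+1})%type.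

Definition standard_tail (n : nat) (e : standard_edge n) :
  ('I_n + attaching n)%type :=
  match e with
  | inl a => inr (inl a)
  | inr (existT l r) => nth (inl l) (inl l :: map inr (line_points n l)) r
  end.

Definition standard_head (n : nat) (e : standard_edge n) :
  (attaching n + 'I_n)%type :=
  match e with
  | inl a => inl (inr a)
  | inr (existT l r) => nth (inr l) (rcons (map inl (line_points n l)) (inr l)) r
  end.

Definition standard (n : nat) : network n :=
  Network (@standard_tail n) (@standard_head n).

(* Weightings of the composites of one, two or three copies of a network. *)
Definition comp1 (R : realType) (n : nat) (N : network n)
  (w1 : weighting R N) : 'I_1 -> weighting R N := tnth [tuple w1].

Definition comp2 (R : realType) (n : nat) (N : network n)
  (w1 w2 : weighting R N) : 'I_2 -> weighting R N := tnth [tuple w1; w2].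

Definition comp3 (R : realType) (n : nat) (N : network n)
  (w1 w2 w3 : weighting R N) : 'I_3 -> weighting R N :=
  tnth [tuple w1; w2; w3].

Definition mfun (R : realType) (n : nat) (N : network n)
  (w1 w2 w3 : weighting R N) (i j k : nat) : \bar R :=
  max_weight (N := fun _ => N) (comp3 w1 w2 w3) (tnth [tuple i; j; k]).

Definition real_GZ (R : realType) (n k : nat) (N : 'I_k -> network n)
  (w : forall j, weighting R (N j)) : Prop :=
  real_singular_values w /\ multi_Gelfand_Zeitlin w.

Definition admissible (R : realType) (n : nat) (N : network n)
  (w1 w2 w3 : weighting R N) : Prop :=
  [/\ real_GZ (N := fun _ => N) (comp1 w1) /\
        real_GZ (N := fun _ => N) (comp1 w2),
      real_GZ (N := fun _ => N) (comp1 w3),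
      real_GZ (N := fun _ => N) (comp2 w1 w2),
      real_GZ (N := fun _ => N) (comp2 w2 w3)
    & real_GZ (N := fun _ => N) (comp3 w1 w2 w3)].

(* Main.v *)
(* All the networks are layered: reading the composite from left to right, one meets
   the slanted edges one at a time, and a family of disjoint paths is described by the
   set of lines that it occupies. So the maximal weight with prescribed ends is computed
   by a recursion on sets, each step of which lets one path move down one line,
   and at the boundary between two networks the lowest paths may stop.

   For two sets X and Y of maximal weights f(X) and f(Y), recolouring the union of two
   optimal families along alternating trails shows that the symmetric difference of X and Y
   carries a perfect matching between X \ Y and Y \ X, without crossings by planarity,
   such that exchanging the ends of any set of arcs does not decrease f(X) + f(Y).
   This property is preserved by each step of the recursion.

   By the Gelfand-Zeitlin condition, the six values in the octahedron relation are
   values of one such f, on sets that differ at four places only, in the cyclic order: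
   the source used by one family only, then the additional sink of each network. There
   are two noncrossing matchings of four points, and they give the three inequalities.

   All the m_{i,j,k} are finite, since a family of n paths has to follow all the
   horizontal lines; so the relation can be solved for one term in either direction. *)
Require Import Defs.
From mathcomp Require Import all_boot all_order all_algebra.
From mathcomp Require Import all_classical all_reals ereal.
From mathcomp Require Import zify.

Set Implicit Arguments.
Unset Strict Implicit.
Unset Printing Implicit Defensive.

Import Order.TTheory GRing.Theory Num.Theory.
Local Open Scope nat_scope.

(** * Noncrossing matchings *)

(** The recolouring is never carried out on paths, since alternating trails would call for an
    embedding that the networks do not record. The exchange property is kept as an invariant of a
    function on sets instead. Apart from positions where both states agree, an elementary step
    affects two positions with no end of an arc between them, so a matching is updated locally: an
    arc is inserted, two arcs are joined, or one end slides past no other end. Planarity enters only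
    because a slanted edge joins neighbouring lines. Paths that stop at different boundaries must
    still be described on one ordered line of positions. This is why a stopped path is recorded by a
    flag below all the lines: the flags of later boundaries are still empty, so the current flag is
    next to the lowest line that remains in use. The identification of the recursion with m has two
    unequal halves. Every value other than -oo is the weight of a genuine multipath, whatever the
    weighting. The Gelfand-Zeitlin condition serves the other half, where a multipath of maximal
    weight must have ends of the one shape that the recursion describes. *)

(* The position 0 flags the lowest source as unused; in a composite of k networks, the
   positions b = 1, ..., k flag one more path stopped at the b-th boundary, and the
   position k + 1 + l is the line l. *)
Definition state := nat -> bool.
Definition flip (X F : state) : state := fun z => X z (+) F z.

(** The exclusive or [(z < t) (+) (pi z < t)] says that [t] lies between the ends of the arc through
    [z], in whichever order these come; so the last clause forbids crossings. Outside the symmetric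
    difference [pi] is arbitrary. *)
Definition matching (X Y : state) (pi : nat -> nat) : Prop :=
  [/\ forall z, X z != Y z -> X (pi z) = Y z /\ Y (pi z) = X z,
      forall z, X z != Y z -> pi (pi z) = z
    & forall z t, X z != Y z -> X t != Y t -> t != z -> t != pi z ->
        (z < t) (+) (pi z < t) = (z < pi t) (+) (pi z < pi t)].

(** One matching serves for all unions [F] of its arcs. The abstract property [P] separates the
    surgery on arcs from the weights. *)
Definition matched (X Y : state) (P : state -> Prop) : Prop :=
  exists2 pi, matching X Y pi &
    forall F : state, (forall z, F z -> X z != Y z) ->
      (forall z, X z != Y z -> F (pi z) = F z) -> P F.

Lemma matching_diff X Y pi z : matching X Y pi -> X z != Y z ->
  X (pi z) != Y (pi z).
Proof. by case=> h _ _ d; case: (h z d) => -> ->; rewrite eq_sym. Qed.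

Lemma matched_sym X Y P : matched X Y P -> matched Y X P.
Proof.
case=> pi [opp inv nc] hP; exists pi; last first.
  by move=> F F1 F2; apply: hP => z; rewrite eq_sym; [apply: F1 | apply: F2].
split=> [z|z|z t]; rewrite eq_sym; first by move=> d; case: (opp z d) => ->.
- exact: inv.
- by move=> d; rewrite eq_sym; exact: nc.
Qed.

(** Monotonicity is asked only at the ends of arcs, which lets an end slide over positions where the
    two states agree. The mask [X0 z != Y0 z] is there because [r'] is uncontrolled elsewhere. *)
Lemma matched_relabel (X0 Y0 X Y : state) (P0 P : state -> Prop) (r r' : nat -> nat) :
  matched X0 Y0 P0 ->
  (forall z, X z != Y z -> [/\ X0 (r z) = X z, Y0 (r z) = Y z & r' (r z) = z]) ->
  (forall z, X0 z != Y0 z ->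
     [/\ X (r' z) = X0 z, Y (r' z) = Y0 z & r (r' z) = z]) ->
  (forall z t, X z != Y z -> X t != Y t -> (r z < r t) = (z < t)) ->
  (forall F : state, (forall z, F z -> X z != Y z) ->
     P0 (fun z => (X0 z != Y0 z) && F (r' z)) -> P F) ->
  matched X Y P.
Proof.
move=> [pi m hP] hr hr' mono hF.
have [opp inv nc] := m.
have dr z : X z != Y z -> X0 (r z) != Y0 (r z).
  by move=> d; have [-> ->] := hr _ d.
have dr' z : X0 z != Y0 z -> X (r' z) != Y (r' z).
  by move=> d; have [-> ->] := hr' _ d.
have dp z d := matching_diff m (dr z d).
exists (fun z => r' (pi (r z))).
  split=> [z d|z d|z t dz dt].
  - have [-> -> _] := hr' _ (dp _ d).
    have [-> ->] := opp _ (dr _ d).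
    by have [-> -> _] := hr _ d.
  - have [_ _ ->] := hr' _ (dp _ d).
    by rewrite inv ?dr//; have [] := hr _ d.
  - move=> tz tpz.
    have := nc _ _ (dr _ dz) (dr _ dt).
    have e1 : r t != r z.
      apply: contra tz => /eqP e; have [_ _ <-] := hr _ dt.
      by rewrite e; have [_ _ ->] := hr _ dz.
    have e2 : r t != pi (r z).
      by apply: contra tpz => /eqP <-; have [_ _ ->] := hr _ dt.
    move=> /(_ e1 e2).
    have [_ _ rz] := hr' _ (dp _ dz).
    have [_ _ rt] := hr' _ (dp _ dt).
    have ddz := dr' _ (dp _ dz); have ddt := dr' _ (dp _ dt).
    have <- := mono _ _ dz dt; have <- := mono _ _ ddz dt.
    have <- := mono _ _ dz ddt; have <- := mono _ _ ddz ddt.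
    by rewrite rz rt.
move=> F F1 F2; apply: hF => //; apply: hP.
  by move=> z /andP[].
move=> z d; rewrite d (matching_diff m d) /=.
have := F2 _ (dr' _ d).
by have [_ _ ->] := hr' _ d.
Qed.

Lemma ltn_sides (u v x : nat) : u < v -> x != u -> x != v ->
  ~~ ((u < x) && (x < v)) -> (u < x) = (v < x) /\ (x < u) = (x < v).
Proof. lia. Qed.

(** The new arc crosses nothing: no other end lies strictly between [u] and [v], so every other end
    sees both on the same side. *)
Lemma matched_insert (X0 Y0 X Y : state) (P0 P : state -> Prop) (u v : nat) :
  matched X0 Y0 P0 -> u < v ->
  X0 u = Y0 u -> X0 v = Y0 v ->
  X u != Y u -> X v = Y u -> Y v = X u ->
  (forall z, z != u -> z != v -> X0 z = X z /\ Y0 z = Y z) ->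
  (forall z, u < z -> z < v -> X z = Y z) ->
  (forall F : state, F u = F v -> (forall z, F z -> X z != Y z) ->
     P0 (fun z => [&& F z, z != u & z != v]) -> P F) ->
  matched X Y P.
Proof.
move=> [pi m hP] uv eu ev du xv yv e0 bt hF.
have [opp inv nc] := m.
have D0 z : X0 z != Y0 z -> (z != u) /\ (z != v).
  move=> d; split; apply: contra d => /eqP->; first by rewrite eu.
  by rewrite ev.
have D z : z != u -> z != v -> X z != Y z -> X0 z != Y0 z.
  by move=> zu zv; have [-> ->] := e0 _ zu zv.
have vu : v != u by rewrite gtn_eqF.
have dv : X v != Y v by rewrite xv yv eq_sym.
pose rho z := if z == u then v else if z == v then u else pi z.
exists rho.
  split=> [z|z|z t]; rewrite /rho.
  - have [->//|zu] := eqVneq z u.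
    have [->//|zv d] := eqVneq z v.
    have d0 := D _ zu zv d.
    have [pu pv] := D0 _ (matching_diff m d0).
    have [<- <-] := e0 _ pu pv.
    by have [<- <-] := e0 _ zu zv; apply: opp.
  - have [->|zu] := eqVneq z u; first by rewrite (negPf vu) eqxx.
    have [->|zv d] := eqVneq z v; first by rewrite eqxx.
    have d0 := D _ zu zv d.
    have [/negPf-> /negPf->] := D0 _ (matching_diff m d0).
    exact: inv.
  - move=> dz dt.
    have out x : X x != Y x -> x != u -> x != v ->
        (u < x) = (v < x) /\ (x < u) = (x < v).
      move=> d xu xv'; apply: ltn_sides => //.
      by apply: contra d => /andP[ux xv2]; rewrite bt.
    have [?|zu] := eqVneq z u; first subst z.
      move=> tu tv; rewrite (negPf tu) (negPf tv).
      have d0 := D _ tu tv dt.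
      have [pu pv] := D0 _ (matching_diff m d0).
      have [|-> _] := out (pi t) _ pu pv.
        by have [<- <-] := e0 _ pu pv; exact: (matching_diff m).
      by have [-> _] := out _ dt tu tv; rewrite !addbb.
    have [?|zv] := eqVneq z v; first subst z.
      move=> tv tu; rewrite (negPf tu) (negPf tv).
      have d0 := D _ tu tv dt.
      have [pu pv] := D0 _ (matching_diff m d0).
      have [|-> _] := out (pi t) _ pu pv.
        by have [<- <-] := e0 _ pu pv; exact: (matching_diff m).
      by have [-> _] := out _ dt tu tv; rewrite !addbb.
    have d0 := D _ zu zv dz.
    have [pu pv] := D0 _ (matching_diff m d0).
    have dpz : X (pi z) != Y (pi z).
      have [<- <-] := e0 _ pu pv; exact: (matching_diff m).
    have [_ oz'] := out _ dz zu zv; have [_ opz'] := out _ dpz pu pv.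
    have [->|tu] := eqVneq t u; first by rewrite oz' opz'.
    have [->|tv] := eqVneq t v; first by rewrite oz' opz'.
    by move=> tz tpz; apply: nc => //; apply: D.
move=> F F1 F2; apply: hF => //.
  by have := F2 _ du; rewrite /rho eqxx.
apply: hP.
  by move=> z /and3P[/F1 d zu zv]; apply: D.
move=> z d; have [zu zv] := D0 _ d.
have [pu pv] := D0 _ (matching_diff m d).
rewrite zu zv pu pv !andbT.
have := F2 z; rewrite /rho (negPf zu) (negPf zv) => -> //.
by have [<- <-] := e0 _ zu zv.
Qed.

(* The arcs ending at u and at u.+1 are joined into one arc. *)
Lemma matched_remove (X0 Y0 X Y : state) (P0 P : state -> Prop) (u : nat) :
  matched X0 Y0 P0 ->
  X0 u != Y0 u -> X0 u.+1 = Y0 u -> Y0 u.+1 = X0 u ->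
  X u = Y u -> X u.+1 = Y u.+1 ->
  (forall z, z != u -> z != u.+1 -> X0 z = X z /\ Y0 z = Y z) ->
  (forall F : state, (forall z, F z -> X z != Y z) ->
     P0 F \/ P0 (fun z => [|| F z, z == u | z == u.+1]) -> P F) ->
  matched X Y P.
Proof.
move=> [pi m hP] du xv yv eu ev e0 hF; set v := u.+1 in xv yv ev e0 hF *.
have [opp inv nc] := m.
have D z : X z != Y z -> (z != u) /\ (z != v).
  move=> d; split; apply: contra d => /eqP->; first by rewrite eu.
  by rewrite ev.
have dv : X0 v != Y0 v by rewrite xv yv eq_sym.
have dE z : X z != Y z -> X0 z != Y0 z.
  by move=> d; have [zu zv] := D _ d; have [-> ->] := e0 _ zu zv.
have dE' z : z != u -> z != v -> X0 z != Y0 z -> X z != Y z.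
  by move=> zu zv; have [-> ->] := e0 _ zu zv.
have inj z t : X0 z != Y0 z -> X0 t != Y0 t -> pi z = pi t -> z = t.
  by move=> dz dt e; rewrite -(inv z)// e inv.
have vu : v != u by rewrite gtn_eqF.
pose rho z := if pi z == u then pi v else if pi z == v then pi u else pi z.
have puu : pi u != u.
  by apply/eqP => e; move: (du); have [] := opp _ du; rewrite e => <-; rewrite eqxx.
have pvv : pi v != v.
  by apply/eqP => e; move: (dv); have [] := opp _ dv; rewrite e => <-; rewrite eqxx.
have rhoD z : X z != Y z -> [/\ X0 (rho z) != Y0 (rho z), rho z != u & rho z != v].
  move=> d; have [zu zv] := D _ d; have d0 := dE _ d.
  rewrite /rho; case: (eqVneq (pi z) u) => [pz|pzu].
    split=> //; first exact: (matching_diff m).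
    apply: contraNneq zv => e; apply/eqP/inj => //; congruence.
  case: (eqVneq (pi z) v) => [pz|pzv]; last by split=> //; exact: (matching_diff m).
  split=> //; first exact: (matching_diff m).
  apply: contraNneq zu => e; apply/eqP/inj => //; congruence.
have opp0 z : X z != Y z -> X0 (rho z) = Y0 z /\ Y0 (rho z) = X0 z.
  move=> d; have d0 := dE _ d; rewrite /rho.
  case: (eqVneq (pi z) u) => [pz|_].
    have [-> ->] := opp _ dv; rewrite xv yv -pz.
    by have [-> ->] := opp _ d0.
  case: (eqVneq (pi z) v) => [pz|_]; last exact: opp.
  have [-> ->] := opp _ du; rewrite -yv -xv -pz.
  by have [-> ->] := opp _ d0.
have side z t : X z != Y z -> X t != Y t -> t != z -> t != rho z ->
    (z < t) (+) (rho z < t) = (z < rho t) (+) (rho z < rho t).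
  move=> dz dt.
  have [zu zv] := D _ dz; have [tu tv] := D _ dt.
  have sides x : x != u -> x != v -> (u < x) = (v < x) /\ (x < u) = (x < v).
    by move=> xu xv'; apply: ltn_sides => //; rewrite /v ltnS ltnNge andNb.
  have sd x : x != u -> x != v -> ((u < x) = (v < x)) * ((x < u) = (x < v)).
    by move=> xu xv'; have [-> ->] := sides _ xu xv'.
  have dz0 := dE _ dz; have dt0 := dE _ dt.
  have ncu := nc _ _ du; have ncv := nc _ _ dv.
  have [_ rzu rzv] := rhoD _ dz; have [_ rtu rtv] := rhoD _ dt.
  move: rzu rzv rtu rtv; rewrite /rho.
  case: (eqVneq (pi z) u) => [pz|pzu].
    have zE : z = pi u by rewrite -pz inv.
    case: (eqVneq (pi t) u) => [pt _ _ _ _ tz|ptu].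
      by move: tz; rewrite (inj t z) ?eqxx// pt pz.
    case: (eqVneq (pi t) v) => [pt _ _ _ _ _|ptv pvu pvv' ptu' ptv' tz tpz].
      by rewrite -pt inv ?eqxx.
    (* Since nothing separates [u] from [v], lying under the joined arc is the exclusive or of lying
       under the two old arcs. The sum of their two noncrossing equations is the equation for the
       joined arc. *)
    have a1 := ncu _ dt0 tu; rewrite -zE in a1; have {}a1 := a1 tz.
    have a2 := ncv _ dt0 tv tpz.
    have [s1 s1'] := sd _ tu tv; have [s2 s2'] := sd _ ptu ptv.
    move: a1 a2; rewrite s1 s2; move: (v < t) (z < t) (pi v < t) (v < pi t) (z < pi t) (pi v < pi t).
    by do 6 case.
  case: (eqVneq (pi z) v) => [pz|pzv].
    have zE : z = pi v by rewrite -pz inv.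
    case: (eqVneq (pi t) u) => [pt _ _ _ _ _|ptu].
      by rewrite -pt inv ?eqxx.
    case: (eqVneq (pi t) v) => [pt _ _ _ _ tz|ptv pvu pvv' ptu' ptv' tz tpz].
      by move: tz; rewrite (inj t z) ?eqxx// pt pz.
    have a1 := ncu _ dt0 tu tpz.
    have a2 := ncv _ dt0 tv; rewrite -zE in a2; have {}a2 := a2 tz.
    have [s1 s1'] := sd _ tu tv; have [s2 s2'] := sd _ ptu ptv.
    move: a1 a2; rewrite s1 s2; move: (v < t) (z < t) (pi u < t) (v < pi t) (z < pi t) (pi u < pi t).
    by do 6 case.
  have [sz sz'] := sd _ zu zv; have [spz spz'] := sd _ pzu pzv.
  case: (eqVneq (pi t) u) => [pt|ptu].
    have tE : t = pi u by rewrite -pt inv.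
    move=> _ _ pvu _ tz tpz.
    have a1 := nc _ _ dz0 dt0 tz tpz.
    have vz : v != pi z by rewrite eq_sym.
    have vz' : v != z by rewrite eq_sym.
    have a2 := nc _ _ dz0 dv vz' vz.
    move: a1 a2; rewrite pt sz' spz' => -> ->.
    by [].
  case: (eqVneq (pi t) v) => [pt|ptv]; last by move=> _ _ _ _; apply: nc.
  move=> _ _ puu' puv tz tpz.
  have a1 := nc _ _ dz0 dt0 tz tpz.
  have uz : u != pi z by rewrite eq_sym.
  have uz' : u != z by rewrite eq_sym.
  have a2 := nc _ _ dz0 du uz' uz.
  by move: a1 a2; rewrite pt sz' spz' => -> ->.
exists rho.
  split=> [z d|z d|] //.
  - have [_ ru rv] := rhoD _ d; have [<- <-] := e0 _ ru rv.
    by have [zu zv] := D _ d; have [<- <-] := e0 _ zu zv; apply: opp0.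
  - have [zu zv] := D _ d; have d0 := dE _ d.
    have [dr ru rv] := rhoD _ d.
    rewrite {1}/rho; move: dr ru rv; rewrite /rho.
    case: (eqVneq (pi z) u) => [pz|pzu].
      by rewrite inv// (negPf vu) eqxx -pz inv.
    case: (eqVneq (pi z) v) => [pz|pzv].
      by rewrite inv// eqxx -pz inv.
    by rewrite inv// (negPf zu) (negPf zv).
move=> F F1 F2; apply: hF => //.
have Fu : F u = false by apply/negbTE/negP => /F1; rewrite eu eqxx.
have Fv : F v = false by apply/negbTE/negP => /F1; rewrite ev eqxx.
have Fz z : X0 z != Y0 z -> pi z != u -> pi z != v -> z != u -> z != v -> F (pi z) = F z.
  move=> d p1 p2 z1 z2; have := F2 z (dE' _ z1 z2 d).
  by rewrite /rho (negPf p1) (negPf p2).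
have pE z x : X0 z != Y0 z -> X0 x != Y0 x -> (pi z == x) = (z == pi x).
  by move=> dz dx; apply/eqP/eqP => [<-|->]; rewrite inv.
(* If [u] and [v] were partners, their arc just disappears, and [F] is already a union of old
   arcs. *)
have [puv|puv] := eqVneq (pi u) v.
  have pvu : pi v = u by rewrite -puv inv.
  left; apply: hP => z.
    by move=> /F1 /dE.
  move=> d; have [->|zu] := eqVneq z u; first by rewrite puv Fu Fv.
  have [->|zv] := eqVneq z v; first by rewrite pvu Fu Fv.
  by apply: Fz => //; rewrite pE// ?puv ?pvu.
have pvu : pi v != u by rewrite pE// eq_sym.
have Fpu : F (pi u) = F (pi v).
  have := F2 (pi u); rewrite /rho inv// eqxx => -> //.
  by apply: dE' => //; exact: (matching_diff m).
(* If [F] contains the joined arc, both old arcs have to be flipped, which adds [u] and [v] to [F];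
   otherwise neither is. *)
case FF : (F (pi u)).
  right; apply: hP => z.
    by case/or3P=> [/F1 /dE||] // /eqP->.
  move=> d; have [->|zu] := eqVneq z u; first by rewrite FF orbT.
  have [->|zv] := eqVneq z v; first by rewrite -Fpu FF !orbT.
  have [e|pzu] := eqVneq (pi z) u; first by rewrite -(inv z)// e FF /= !orbT.
  have [e|pzv] := eqVneq (pi z) v; first by rewrite -(inv z)// e -Fpu FF /= !orbT.
  by rewrite !orbF; apply: Fz.
left; apply: hP => z.
  by move=> /F1 /dE.
move=> d; have [->|zu] := eqVneq z u; first by rewrite FF Fu.
have [->|zv] := eqVneq z v; first by rewrite -Fpu FF Fv.
have [e|pzu] := eqVneq (pi z) u; first by rewrite e Fu -(inv z)// e FF.
have [e|pzv] := eqVneq (pi z) v; first by rewrite e Fv -(inv z)// e -Fpu FF.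
exact: Fz.
Qed.

(** * The exchange property *)

Lemma matched_refl (X : state) (P : state -> Prop) : P (fun _ => false) -> matched X X P.
Proof.
move=> h; exists id; first by split=> [z|z|z t]; rewrite eqxx.
move=> F F1 _; suff -> : F = (fun _ => false) by [].
by apply: funext => z; apply/negP => /F1; rewrite eqxx.
Qed.

Lemma matched_congr (X0 Y0 X Y : state) (P : state -> Prop) :
  (forall z, X z != Y z -> X0 z = X z /\ Y0 z = Y z) ->
  (forall z, X0 z != Y0 z -> X z = X0 z /\ Y z = Y0 z) ->
  matched X0 Y0 P -> matched X Y P.
Proof.
move=> h h0 m; apply: (matched_relabel (r := id) (r' := id) m) => //.
- by move=> z /h[].
- by move=> z /h0[].
move=> F F1; congr P; apply: funext => z.
have := F1 z; case: (F z) => [/(_ isT) d|]; rewrite ?andbF ?andbT//.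
by have [-> ->] := h z d; rewrite d.
Qed.

Lemma matched_impl (X Y : state) (P Q : state -> Prop) :
  (forall F : state, (forall z, F z -> X z != Y z) -> P F -> Q F) ->
  matched X Y P -> matched X Y Q.
Proof. by move=> h [pi m hP]; exists pi => // F F1 F2; apply: h => //; apply: hP. Qed.

(** When one of the values is -oo the inequality is trivial, but a perfect matching may fail to
    exist; hence the restriction. *)
Definition exchangeable (R : realType) (f : state -> \bar R) : Prop :=
  forall X Y : state, f X != -oo%E -> f Y != -oo%E ->
    matched X Y (fun F => f X + f Y <= f (flip X F) + f (flip Y F))%E.

Definition add_weights (R : realType) (n off : nat) (u : 'I_n -> \bar R)
  (f : state -> \bar R) : state -> \bar R :=
  fun X => (f X + \sum_(l < n) (if X (off + l)%N then u l else 0))%E.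

(** The added term is a sum over positions, and an exchange only moves positions between the two
    states, so both sides grow by the same amount. *)
Lemma exchangeable_add_weights (R : realType) (n off : nat) (u : 'I_n -> \bar R)
    (f : state -> \bar R) :
  exchangeable f -> exchangeable (add_weights off u f).
Proof.
move=> ex X Y; rewrite /add_weights !adde_eq_ninfty !negb_or.
move=> /andP[fX _] /andP[fY _].
apply: matched_impl (ex X Y fX fY) => F F1 h.
rewrite addeACA [leRHS]addeACA; apply: leeD => //.
rewrite -!big_split /=; rewrite le_eqVlt; apply/orP; left; apply/eqP.
apply: eq_bigr => l _; rewrite /flip.
have := F1 (off + l); case: (F _) => [/(_ isT)|_]; last by rewrite !addbF.
by case: (X _); case: (Y _) => //= _; rewrite addeC.
Qed.

(** * Moving one path down by one line *)

Definition transp (u v z : nat) : nat := if z == u then v else if z == v then u else z.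

Lemma transpK u v : involutive (transp u v).
Proof.
move=> z; rewrite /transp; have [->|zu] := eqVneq z u.
  by have [->|] := eqVneq v u; rewrite ?eqxx.
have [->|zv] := eqVneq z v; first by rewrite eqxx.
by rewrite (negPf zu) (negPf zv).
Qed.

Lemma transpl u v : transp u v u = v. Proof. by rewrite /transp eqxx. Qed.

Lemma transpr u v : transp u v v = u.
Proof. by rewrite /transp eqxx; case: eqVneq. Qed.

Lemma transp_id u v z : z != u -> z != v -> transp u v z = z.
Proof. by rewrite /transp => /negPf-> /negPf->. Qed.

Lemma transp_mono q z t : (z == q -> t != q.+1) -> (t == q -> z != q.+1) ->
  (transp q q.+1 z < transp q q.+1 t) = (z < t).
Proof. by rewrite /transp; do 4 (case: eqVneq => ? ); lia. Qed.

(* Position q.+1 may move down to q, at the cost w. *)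
Definition step_down (R : realType) (q : nat) (w : \bar R) (f : state -> \bar R) :
  state -> \bar R :=
  fun X => maxe (f X)
    (if X q && ~~ X q.+1 then (f (X \o transp q q.+1) + w)%E else -oo%E).

Lemma step_down_stay (R : realType) q (w : \bar R) f (X : state) : (f X <= step_down q w f X)%E.
Proof. by rewrite /step_down le_max lexx. Qed.

Lemma step_down_move (R : realType) q (w : \bar R) f (X : state) : X q -> ~~ X q.+1 ->
  (f (X \o transp q q.+1) + w <= step_down q w f X)%E.
Proof. by rewrite /step_down => -> ->; rewrite le_max lexx orbT. Qed.

Lemma step_downP (R : realType) q (w : \bar R) f (X : state) : step_down q w f X != -oo%E ->
  (f X != -oo%E /\ step_down q w f X = f X) \/
  [/\ X q, ~~ X q.+1, f (X \o transp q q.+1) != -oo%E &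
      step_down q w f X = (f (X \o transp q q.+1) + w)%E].
Proof.
rewrite /step_down maxElt; case: ifP => _; last by left.
case: ifP => [/andP[Xq Xq1]|//]; rewrite adde_eq_ninfty negb_or => /andP[h _].
by right.
Qed.

Lemma state_eq2 (X Y : state) u v : X u = Y u -> X v = Y v ->
  (forall z, z != u -> z != v -> X z = Y z) -> X = Y.
Proof.
move=> hu hv h; apply: funext => z.
have [->//|zu] := eqVneq z u; have [->//|zv] := eqVneq z v; exact: h.
Qed.

(** The case where [X] makes the move and [Y] does not. This is where the matching really changes,
    in a way that depends on [Y] at the two lines [q] and [q.+1]. *)
Lemma step_down_mixed (R : realType) q (w : \bar R) f (X : state) Y :
  exchangeable f -> X q -> ~~ X q.+1 -> f (X \o transp q q.+1) != -oo%E ->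
  f Y != -oo%E ->
  matched X Y (fun F => f (X \o transp q q.+1) + w + f Y <=
    step_down q w f (flip X F) + step_down q w f (flip Y F))%E.
Proof.
move=> ex Xq /negbTE Xq1 fX fY; set s := transp q q.+1; set X0 := X \o s.
have sq : s q = q.+1 by rewrite /s transpl.
have sq1 : s q.+1 = q by rewrite /s transpr.
have sid z : z != q -> z != q.+1 -> s z = z by apply: transp_id.
have m0 := ex _ _ fX fY; rewrite -/s -/X0 in m0.
have sym (Z : state) : Z q = Z q.+1 -> Z \o s = Z.
  by move=> e; apply: (@state_eq2 _ _ q q.+1) => [||z zq zq1] /=; rewrite ?sq ?sq1 ?sid.
have stay (Z A : state) : A = Z -> (f A <= step_down q w f Z)%E by move=> ->; apply: step_down_stay.
have move_ (Z A : state) : A = Z \o s -> Z q -> Z q.+1 = false -> (f A + w <= step_down q w f Z)%E.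
  by move=> -> h1 h2; apply: step_down_move; rewrite ?h2.
(* Exactly one of the two new states occupies [q] alone; it makes the move and collects [w], while
   the other is fixed by the transposition. *)
have two (Z1 Z2 A1 A2 : state) :
    A1 = Z1 \o s -> A2 = Z2 \o s ->
    [/\ Z1 q, Z1 q.+1 = false & Z2 q = Z2 q.+1] \/
    [/\ Z2 q, Z2 q.+1 = false & Z1 q = Z1 q.+1] ->
    (f A1 + f A2 + w <= step_down q w f Z1 + step_down q w f Z2)%E.
  move=> e1 e2 [[h1 h2 h3]|[h1 h2 h3]].
    by rewrite addeAC; apply: leeD; [apply: move_ | apply: stay; rewrite e2 sym].
  by rewrite -addeA; apply: leeD; [apply: stay; rewrite e1 sym | apply: move_].
have fin (Z1 Z2 : state) (F : state) :
    (f X0 + f Y <= f (flip X0 F) + f (flip Y F))%E ->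
    (f (flip X0 F) + f (flip Y F) + w <= step_down q w f Z1 + step_down q w f Z2)%E ->
    (f X0 + w + f Y <= step_down q w f Z1 + step_down q w f Z2)%E.
  by move=> h1 h2; apply: le_trans h2; rewrite addeAC; apply: leeD.
(* If [Y] takes the same value at both lines, exactly one of them is an end of an arc, before and
   after the move. The transposition slides this end to the neighbouring position. *)
have [Yqq|Yqq] := eqVneq (Y q) (Y q.+1).
  apply: (matched_relabel (r := s) (r' := s) m0).
  - move=> z d; rewrite /X0 /= /s transpK; split=> //.
    by rewrite -[LHS]/((Y \o s) z) sym.
  - move=> z d; rewrite /X0 /= /s transpK; split=> //.
    by rewrite -[LHS]/((Y \o s) z) sym.
  - have nb : X q != Y q -> X q.+1 != Y q.+1 -> False.
      by rewrite Xq Xq1 -Yqq; case: (Y q).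
    move=> z t dz dt; apply: transp_mono => /eqP e; apply/eqP => e'; subst.
      exact: nb dz dt.
    exact: nb dt dz.
  move=> F F1 h; apply: fin h _.
  have Fq := F1 q; have Fq1 := F1 q.+1; rewrite ?Xq ?Xq1 in Fq Fq1.
  apply: two.
  - apply: (@state_eq2 _ _ q q.+1) => [||z zq zq1] /=; rewrite /flip /X0 /=
      ?sq ?sq1 ?sid//.
    + by move: Fq1; rewrite -?Yqq ?Xq1; case: (F q.+1); case: (Y q) => //= /(_ isT).
    + by move: Fq; rewrite -?Yqq ?Xq; case: (F q); case: (Y q) => //= /(_ isT).
    + by have := F1 z; case: (F z) => [/(_ isT)->|]; rewrite ?andbF.
  - apply: (@state_eq2 _ _ q q.+1) => [||z zq zq1] /=; rewrite /flip /X0 /=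
      ?sq ?sq1 ?sid//.
    + by move: Fq1; rewrite -?Yqq ?Xq1; case: (F q.+1); case: (Y q) => //= /(_ isT).
    + by move: Fq; rewrite -?Yqq ?Xq; case: (F q); case: (Y q) => //= /(_ isT).
    + by have := F1 z; case: (F z) => [/(_ isT)->|]; rewrite ?andbF.
  - rewrite /flip Xq Xq1; move: Fq Fq1; rewrite -Yqq.
    case: (Y q); case: (F q); case: (F q.+1) => //.
    + by move=> /(_ isT).
    + by move=> /(_ isT).
    + by move=> _ _; right.
    + by move=> _ _; left.
    + by move=> _ /(_ isT).
    + by move=> _ _; right.
    + by move=> _ /(_ isT).
    + by move=> _ _; left.
(* Both lines were ends of arcs before the move and none is afterwards, so the two arcs are joined.
   Flipping [q] and [q.+1] or not decides which of the two new states makes the move. *)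
have [Yq|Yq] := boolP (Y q).
  have Yq1 : Y q.+1 = false by move: Yqq; rewrite Yq; case: (Y q.+1).
  apply: (matched_remove (u := q) m0); rewrite /X0 /= ?sq ?sq1 ?Xq ?Xq1 ?Yq ?Yq1//.
    by move=> z zq zq1; rewrite sid.
  move=> F F1.
  have Fq : F q = false by apply/negP => /F1; rewrite Xq Yq.
  have Fq1 : F q.+1 = false by apply/negP => /F1; rewrite Xq1 Yq1.
  case=> h; apply: fin h _.
    rewrite addeAC; apply: leeD; last exact: step_down_stay.
    apply: move_; rewrite /flip ?Xq ?Xq1 ?Fq ?Fq1//.
    by apply: (@state_eq2 _ _ q q.+1) => [||z zq zq1] /=; rewrite /X0 /= ?sq ?sq1 ?sid// ?Fq ?Fq1.
  rewrite -addeA; apply: leeD.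
    apply: stay; rewrite /flip /X0 /=.
    apply: (@state_eq2 _ _ q q.+1) => [||z zq zq1] /=; rewrite ?sq ?sq1 ?sid// ?Fq ?Fq1 ?Xq ?Xq1 ?eqxx ?orbT//.
    by rewrite (negPf zq) (negPf zq1) !orbF.
  apply: move_; rewrite /flip ?Yq ?Yq1 ?Fq ?Fq1//.
  apply: (@state_eq2 _ _ q q.+1) => [||z zq zq1] /=; rewrite ?sq ?sq1 ?sid// ?Fq ?Fq1 ?Yq ?Yq1 ?eqxx ?orbT//.
  by rewrite (negPf zq) (negPf zq1) !orbF.
(* Before the move the states agreed at both lines; now [X] has [q] and [Y] has [q.+1], which are
   joined by a new arc. If this arc is flipped, the move is made by the state obtained from [Y]. *)
have Yq1 : Y q.+1 by move: Yqq; rewrite (negPf Yq); case: (Y q.+1).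
apply: (matched_insert (u := q) (v := q.+1) m0); rewrite /X0 /= ?sq ?sq1 ?Xq ?Xq1 ?(negPf Yq) ?Yq1//.
- by move=> z zq zq1; rewrite sid.
- by move=> z; rewrite ltnS ltnNge => /negbTE->.
move=> F FF F1 h; apply: fin h _; move/negPf in Yq.
have [Fq|Fq] := boolP (F q); rewrite ?(negPf Fq) ?Fq in FF; have Fq1 := esym FF.
  rewrite -addeA; apply: leeD.
    apply: stay; rewrite /flip /X0 /=.
    apply: (@state_eq2 _ _ q q.+1) => [||z zq zq1] /=; rewrite ?sq ?sq1 ?sid// ?Fq ?Fq1 ?Xq ?Xq1 ?eqxx ?andbF//=.
    by rewrite zq zq1 !andbT.
  apply: move_; rewrite /flip ?Yq ?Yq1 ?Fq ?Fq1//.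
  apply: (@state_eq2 _ _ q q.+1) => [||z zq zq1] /=; rewrite ?sq ?sq1 ?sid// ?Fq ?Fq1 ?Yq ?Yq1 ?eqxx ?andbF//=.
  by rewrite zq zq1 !andbT.
move/negPf in Fq.
rewrite addeAC; apply: leeD.
  apply: move_; rewrite /flip ?Xq ?Xq1 ?Fq ?Fq1//.
  apply: (@state_eq2 _ _ q q.+1) => [||z zq zq1] /=; rewrite /X0 /= ?sq ?sq1 ?sid// ?Fq ?Fq1 ?Xq ?Xq1//=.
  by rewrite zq zq1 !andbT.
apply: stay; rewrite /flip.
apply: (@state_eq2 _ _ q q.+1) => [||z zq zq1] /=; rewrite ?sq ?sq1 ?sid// ?Fq ?Fq1 ?Yq ?Yq1//=.
by rewrite zq zq1 !andbT.
Qed.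

Lemma exchangeable_step_down (R : realType) q (w : \bar R) f :
  exchangeable f -> exchangeable (step_down q w f).
Proof.
move=> ex X Y dX dY.
have [[fX ->]|[Xq Xq1 fX ->]] := step_downP dX; have [[fY ->]|[Yq Yq1 fY ->]] := step_downP dY.
- apply: matched_impl (ex _ _ fX fY) => F _ h; apply: le_trans h _.
  by apply: leeD; apply: step_down_stay.
- rewrite addeC; apply/matched_sym; apply: matched_impl (step_down_mixed w ex Yq Yq1 fY fX) => F _.
  by rewrite [(step_down _ _ _ (flip Y F) + _)%E]addeC.
- exact: step_down_mixed.
(* Both states make the move, so they agree at [q] and at [q.+1], the arcs are unchanged, and [w] is
   collected twice on each side. *)
set s := transp q q.+1 in fX fY *; move/negPf in Xq1; move/negPf in Yq1.
apply: (matched_relabel (r := s) (r' := s) (ex _ _ fX fY)).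
- by move=> z _ /=; rewrite /s !transpK.
- by move=> z _ /=; rewrite /s !transpK.
- by move=> z t dz dt; apply: transp_mono => /eqP e; subst; move: dz dt; rewrite ?Xq ?Yq.
move=> F F1 h.
have Fq : F q = false by apply/negP => /F1; rewrite Xq Yq.
have Fq1 : F q.+1 = false by apply/negP => /F1; rewrite Xq1 Yq1.
rewrite addeACA; have : (w + w <= w + w)%E by []. 
move=> /(leeD h) /le_trans; apply; rewrite addeACA; apply: leeD.
  apply: le_trans (step_down_move _ _ _ _); rewrite /flip ?Xq ?Xq1 ?Fq ?Fq1//.
  rewrite le_eqVlt; apply/orP; left; apply/eqP; congr (f _ + _)%E; apply: funext => z /=.
  by congr (_ (+) _); have := F1 (s z); case: (F _) => [/(_ isT)->|]; rewrite ?andbF.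
apply: le_trans (step_down_move _ _ _ _); rewrite /flip ?Yq ?Yq1 ?Fq ?Fq1//.
rewrite le_eqVlt; apply/orP; left; apply/eqP; congr (f _ + _)%E; apply: funext => z /=.
by congr (_ (+) _); have := F1 (s z); case: (F _) => [/(_ isT)->|]; rewrite ?andbF.
Qed.

(** Recovers the state just before a boundary from the state [X] just after it: the paths that
    stopped stand on their lines again, and the flag [a] is cleared. *)
Definition thaw (a lo p : nat) (X : state) : state := fun z =>
  if z == a then false else if z == p then X p || X a else (lo <= z < p) || X z.

(* The paths at the positions lo, ..., p.-1 stop; the path at p stops if the flag a
   is set and goes on if p is. *)
Definition freeze (R : realType) (a lo p : nat) (f : state -> \bar R) :
  state -> \bar R :=
  fun X => if ~~ (X a && X p) && [forall z : 'I_p, (lo <= z) ==> ~~ X z]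
           then f (thaw a lo p X) else -oo%E.

Lemma freezeE (R : realType) a lo p (f : state -> \bar R) (X : state) :
  ~~ (X a && X p) -> (forall z, lo <= z -> z < p -> X z = false) ->
  freeze a lo p f X = f (thaw a lo p X).
Proof.
move=> h1 h2; rewrite /freeze h1 (_ : [forall _, _] = true) //.
by apply/forallP => z; apply/implyP => h; rewrite h2.
Qed.

Lemma freezeP (R : realType) a lo p (f : state -> \bar R) (X : state) :
  freeze a lo p f X != -oo%E ->
  [/\ ~~ (X a && X p), forall z, lo <= z -> z < p -> X z = false,
      f (thaw a lo p X) != -oo%E & freeze a lo p f X = f (thaw a lo p X)].
Proof.
rewrite /freeze; case: ifP => // /andP[h1 /forallP h2] h3; split=> // z z1 z2.
by have /implyP/(_ z1)/negbTE := h2 (Ordinal z2).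
Qed.

(** The flags of boundaries not yet reached are down, so no end of an arc lies between the flag
    about to be used and the lines. *)
Definition unset (R : realType) (a off : nat) (f : state -> \bar R) : Prop :=
  forall X, f X != -oo%E -> forall z, a <= z -> z < off -> X z = false.

Lemma unset_add_weights (R : realType) a (n off : nat) (u : 'I_n -> \bar R) f :
  unset a off f -> unset a off (add_weights off u f).
Proof.
move=> h X; rewrite /add_weights adde_eq_ninfty negb_or => /andP[fX _].
exact: h.
Qed.

Lemma unset_step_down (R : realType) a off q (w : \bar R) f :
  off <= q -> unset a off f -> unset a off (step_down q w f).
Proof.
move=> hq h X /step_downP[[fX _]|[_ _ fX _]]; first exact: h.
by move=> z z1 z2; have := h _ fX z z1 z2; rewrite /= transp_id//; lia.
Qed.

Lemma unset_freeze (R : realType) a off lo p (f : state -> \bar R) :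
  off <= lo -> off <= p -> unset a off f -> unset a.+1 off (freeze a lo p f).
Proof.
move=> h1 h2 h X /freezeP[_ _ fX _] z z1 z2.
have := h _ fX z (ltnW z1) z2; rewrite /thaw gtn_eqF//.
rewrite ltn_eqF; last exact: leq_trans z2 h2.
by case: (X z) => //; rewrite orbT.
Qed.

Lemma freeze_flip (R : realType) a p off (f : state -> \bar R) (X F : state) :
  freeze a off p f X != -oo%E -> (forall z, off <= z -> z < p -> F z = false) ->
  ~~ (flip X F a && flip X F p) ->
  freeze a off p f (flip X F) = f (thaw a off p (flip X F)).
Proof.
move=> /freezeP[_ h _ _] hF h2; apply: freezeE => // z z1 z2.
by rewrite /flip h// hF.
Qed.

(** After the boundary the two states agree everywhere strictly between the flag [a] and the line
    [p]: the later flags are down and the lines below [p] have been vacated. So [a] and [p] behave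
    like neighbours. *)
Lemma exchangeable_freeze (R : realType) a off p (f : state -> \bar R) :
  a < off -> off <= p -> unset a off f -> exchangeable f ->
  exchangeable (freeze a off p f).
Proof.
move=> aoff offp uf ex X Y dX dY.
have ap : a < p by apply: leq_trans offp.
have pa : p != a by rewrite gtn_eqF.
wlog XY : X Y dX dY / Y a ==> X a => [th|].
  case: (boolP (Y a ==> X a)) => h; first exact: th.
  rewrite addeC; apply/matched_sym.
  have := th Y X dY dX; rewrite implybE; move: h; rewrite negb_imply => /andP[-> /negbTE->] /(_ isT).
  by apply: matched_impl => F _; rewrite [X in (_ <= X)%E -> _]addeC.
have [X1 X2 fX eX] := freezeP dX; have [Y1 Y2 fY eY] := freezeP dY.
have uX := uf _ fX; have uY := uf _ fY.
have ta Z : thaw a off p Z a = false by rewrite /thaw eqxx.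
have tp Z : thaw a off p Z p = Z p || Z a by rewrite /thaw (negPf pa) eqxx.
have tz Z z : z != a -> z != p -> thaw a off p Z z = (off <= z < p) || Z z.
  by rewrite /thaw => /negPf-> /negPf->.
have eqD (F : state) : (forall z, F z -> X z != Y z) ->
    forall z, off <= z -> z < p -> F z = false.
  by move=> F1 z z1 z2; apply/negP => /F1; rewrite X2// Y2.
have flipt (Z F : state) z : z != a -> z != p -> (off <= z -> z < p -> F z = false) ->
    thaw a off p (flip Z F) z = thaw a off p Z z (+) F z.
  move=> za zp h; rewrite !tz// /flip; case: (boolP (off <= z < p)) => // /andP[z1 z2].
  by rewrite h.
have tD z : z != a -> z != p ->
    (thaw a off p X z != thaw a off p Y z) = (X z != Y z).
  move=> za zp; rewrite !tz//; case: (boolP (off <= z < p)) => // /andP[z1 z2].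
  by rewrite X2 ?Y2.
have mid z : a < z -> z < p -> X z = Y z.
  move=> z1 z2; have [zo|zo] := ltnP z off; last by rewrite X2 ?Y2.
  have za : z != a by rewrite gtn_eqF.
  have zp : z != p by rewrite ltn_eqF.
  have := uX z (ltnW z1) zo; have := uY z (ltnW z1) zo; rewrite !tz// leqNgt zo /=.
  by move=> -> ->.
have goal (F F0 : state) : (forall z, F z -> X z != Y z) ->
    (f (thaw a off p X) + f (thaw a off p Y) <=
     f (flip (thaw a off p X) F0) + f (flip (thaw a off p Y) F0))%E ->
    ~~ (flip X F a && flip X F p) -> ~~ (flip Y F a && flip Y F p) ->
    flip (thaw a off p X) F0 = thaw a off p (flip X F) ->
    flip (thaw a off p Y) F0 = thaw a off p (flip Y F) ->
    (freeze a off p f X + freeze a off p f Y <=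
     freeze a off p f (flip X F) + freeze a off p f (flip Y F))%E.
  move=> F1 h h1 h2 h3 h4; rewrite eX eY !freeze_flip//; last 2 first.
  - exact: eqD.
  - exact: eqD.
  by rewrite -h3 -h4.
have m0 := ex _ _ fX fY.
(* If both flags are set, neither state has a path left at [p]; whether they are set or not, equal
   flags leave the symmetric difference the same on both sides of the boundary. *)
have [XYa|XYa] := eqVneq (X a) (Y a).
  apply: (matched_relabel (r := id) (r' := id) m0) => //.
  - move=> z d; have za : z != a by apply: contraNneq d => ->; rewrite XYa.
    have [zp|zp] := eqVneq z p.
      subst z; rewrite !tp; move: d X1 Y1; rewrite -XYa.
      by case: (X a); case: (X p); case: (Y p).
    rewrite !tz//; suff -> : (off <= z < p) = false by [].
    by apply/negP => /andP[z1 z2]; move: d; rewrite X2 ?Y2.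
  - move=> z d; have za : z != a by apply: contraNneq d => ->; rewrite !ta.
    have [zp|zp] := eqVneq z p.
      subst z; move: d X1 Y1; rewrite !tp -XYa.
      by case: (X a); case: (X p); case: (Y p).
    move: d; rewrite !tz//; case: (off <= z < p) => //.
  move=> F F1 h; have Fa : F a = false by apply/negP => /F1; rewrite XYa eqxx.
  apply: goal h _ _ _ _ => //.
  - have := F1 p; move: X1 Y1; rewrite /flip Fa -XYa.
    by case: (X a); case: (F p); case: (X p); case: (Y p) => //= _ _ /(_ isT).
  - have := F1 p; move: X1 Y1; rewrite /flip Fa -XYa.
    by case: (X a); case: (F p); case: (X p); case: (Y p) => //= _ _ /(_ isT).
  - apply: (@state_eq2 _ _ a p) => [||z za zp]; rewrite /flip ?ta ?Fa//.
    + have := F1 p; move: X1 Y1; rewrite !tp Fa -XYa addbF.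
      by case: (X a); case: (F p); case: (X p); case: (Y p) => //= _ _ /(_ isT).
    + rewrite -/(flip X F) flipt//; last exact: eqD.
      by rewrite tD//; have := F1 z; case: (F z) => [/(_ isT)->|]; rewrite ?andbF.
  - apply: (@state_eq2 _ _ a p) => [||z za zp]; rewrite /flip ?ta ?Fa//.
    + have := F1 p; move: X1 Y1; rewrite !tp Fa -XYa addbF.
      by case: (X a); case: (F p); case: (X p); case: (Y p) => //= _ _ /(_ isT).
    + rewrite -/(flip Y F) flipt//; last exact: eqD.
      by rewrite tD//; have := F1 z; case: (F z) => [/(_ isT)->|]; rewrite ?andbF.
have Xa : X a by move: XY XYa; case: (X a); case: (Y a).
have Ya : Y a = false by move: XYa; rewrite Xa; case: (Y a).
have Xp : X p = false by move: X1; rewrite Xa; case: (X p).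
have F0z (F : state) z : (forall z, F z -> X z != Y z) -> z != a -> z != p ->
    (thaw a off p X z != thaw a off p Y z) && F z = F z.
  by move=> F1 za zp; rewrite tD//; have := F1 z; case: (F z) => [/(_ isT)->|]; rewrite ?andbF.
(* Both states occupied [p] before the boundary; the path of [X] has stopped there and that of [Y]
   goes on, so a new arc joins the flag to [p]. *)
have [Yp|Yp] := boolP (Y p).
  (* Inserting an arc requires old and new states to agree off its ends, whereas thawing also fills
     the lines below [p]. It fills them in both states, so only the changes at [a] and [p] need to
     be kept. *)
  pose keep (Z : state) : state := fun z => if (z == a) || (z == p) then thaw a off p Z z else Z z.
  have ka Z : keep Z a = false by rewrite /keep eqxx ta.
  have kp Z : keep Z p = Z p || Z a by rewrite /keep eqxx orbT tp.
  have kz Z z : z != a -> z != p -> keep Z z = Z z by rewrite /keep => /negPf-> /negPf->.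
  have m1 : matched (keep X) (keep Y) (fun F =>
      (f (thaw a off p X) + f (thaw a off p Y) <=
       f (flip (thaw a off p X) F) + f (flip (thaw a off p Y) F))%E).
    apply: matched_congr m0 => z.
      have [->|za] := eqVneq z a; first by rewrite !ka.
      have [->|zp] := eqVneq z p; first by rewrite !kp !tp.
      rewrite !kz// !tz//; case: (boolP (off <= z < p)) => // /andP[z1 z2].
      by rewrite X2// Y2.
    have [->|za] := eqVneq z a; first by rewrite !ta.
    have [->|zp] := eqVneq z p; first by rewrite !kp !tp.
    by rewrite !kz// !tz//; case: (off <= z < p).
  apply: (matched_insert (u := a) (v := p) m1) => //.
  - by rewrite !ka.
  - by rewrite !kp Xa Yp orbT.
  - by rewrite Xp Ya.
  - by rewrite Xa Yp.
  - by move=> z za zp; rewrite !kz.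
  move=> F FF F1 h; apply: goal h _ _ _ _ => //.
  - by rewrite /flip Xa Xp FF; case: (F p).
  - by rewrite /flip Ya Yp FF; case: (F p).
  - apply: (@state_eq2 _ _ a p) => [||z za zp]; rewrite /flip ?ta ?eqxx ?andbF//.
    + by rewrite !tp Xa Xp FF; case: (F p).
    + by rewrite -/(flip X F) flipt ?za ?zp ?andbT//; exact: eqD.
  - apply: (@state_eq2 _ _ a p) => [||z za zp]; rewrite /flip ?ta ?eqxx ?andbF//.
    + by rewrite !tp Ya Yp FF; case: (F p).
    + by rewrite -/(flip Y F) flipt ?za ?zp ?andbT//; exact: eqD.
(* Only [X] had a path at [p], and it has stopped: the end of its arc slides from [p] to the
   flag. *)
move/negPf in Yp.
have sa : transp a p a = p by rewrite transpl.
have sp : transp a p p = a by rewrite transpr.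
have sz z : z != a -> z != p -> transp a p z = z by apply: transp_id.
have Dp z : X z != Y z -> z != p by apply: contraNneq => ->; rewrite Xp Yp.
have Da z : thaw a off p X z != thaw a off p Y z -> z != a.
  by apply: contraNneq => ->; rewrite !ta.
apply: (matched_relabel (r := transp a p) (r' := transp a p) m0).
- move=> z d; rewrite transpK; have zp := Dp _ d.
  have [->|za] := eqVneq z a; first by rewrite sa !tp Xp Yp.
  rewrite sz// !tz//; suff -> : (off <= z < p) = false by [].
  by apply/negP => /andP[z1 z2]; move: d; rewrite X2 ?Y2.
- move=> z d; rewrite transpK; have za := Da _ d.
  have [->|zp] := eqVneq z p; first by rewrite sp !tp Xp Yp.
  by move: d; rewrite sz// !tz//; case: (off <= z < p).
- have aux z : X z != Y z -> z != a -> (p < z) = (a < z) /\ (z < p) = (z < a).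
    move=> d za; have zp := Dp _ d.
    have nb : ~~ ((a < z) && (z < p)) by apply: contra d => /andP[z1 z2]; rewrite mid.
    by have [-> ->] := ltn_sides ap za zp nb.
  move=> z t dz dt; have zp := Dp _ dz; have tp' := Dp _ dt.
  have [->|za] := eqVneq z a; have [->|ta'] := eqVneq t a; rewrite ?sa ?ltnn//.
  + by rewrite sz//; have [] := aux _ dt ta'.
  + by rewrite sz//; have [] := aux _ dz za.
  + by rewrite !sz.
move=> F F1 h.
have Fp : F p = false by apply/negP => /F1; rewrite Xp Yp.
apply: goal h _ _ _ _ => //.
- by rewrite /flip Xp Fp andbF.
- by rewrite /flip Yp Fp andbF.
- apply: (@state_eq2 _ _ a p) => [||z za zp]; rewrite /flip ?ta ?eqxx//.
  + by rewrite !tp sp Xa Ya Xp Yp Fp.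
  + by rewrite -/(flip X F) flipt ?sz//; [rewrite F0z | exact: eqD].
- apply: (@state_eq2 _ _ a p) => [||z za zp]; rewrite /flip ?ta ?eqxx//.
  + by rewrite !tp sp Xa Ya Xp Yp Fp.
  + by rewrite -/(flip Y F) flipt ?sz//; [rewrite F0z | exact: eqD].
Qed.

(** * Initial states, and the four flags of a composite of three networks *)

Definition initial (R : realType) (I : state -> Prop) : state -> \bar R :=
  fun X => if `[< I X >] then 0%E else -oo%E.

Lemma initialP (R : realType) I X : @initial R I X != -oo%E ->
  I X /\ @initial R I X = 0%E.
Proof. by rewrite /initial; case: asboolP. Qed.

(* The highest S sources, the lowest of which is not used (but flagged at
   position 0) if e holds. *)
Definition top_sources (n off S : nat) (e : bool) : state := fun z =>
  if z == 0 then e else (off <= z < off + n) && (n + off <= z + (S - e)).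

Definition top_start (n off S : nat) (X : state) : Prop :=
  exists e, X = top_sources n off S e.

(** There are only two initial states. They differ at the flag 0 and at the lowest of the [S]
    sources, and so have a single arc between them. *)
Lemma exchangeable_top_start (R : realType) (n off S : nat) :
  0 < off -> 0 < S <= n -> exchangeable (@initial R (top_start n off S)).
Proof.
move=> off0 /andP[S0 Sn] X Y /initialP[[e eX] fX] /initialP[[e' eY] fY].
rewrite fX fY; have f0 b : @initial R (top_start n off S) (top_sources n off S b) = 0%E.
  by rewrite /initial asboolT//; exists b.
wlog ee : X Y e e' eX eY fX fY / e' ==> e => [th|].
  case: (boolP (e' ==> e)) => h; first exact: (th X Y e e').
  apply/matched_sym/(matched_impl _ (th Y X e' e eY eX fY fX _)).
    by move=> F _; rewrite [X in (_ <= X)%E -> _]addeC.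
  by move: h; case: e' {eY}; case: e {eX}.
case: e ee eX => [_|]; last first.
  case: e' eY => // -> _ ->; apply: matched_refl; rewrite /flip.
  by rewrite (_ : (fun z => _) = top_sources n off S false) ?f0//; apply: funext => z; rewrite addbF.
case: e' eY => -> ->.
  apply: matched_refl; rewrite /flip.
  by rewrite (_ : (fun z => _) = top_sources n off S true) ?f0//; apply: funext => z; rewrite addbF.
pose v := off + (n - S).
(* The common part of the two states: the highest [S - 1] sources, without the flag. *)
pose Z : state := fun z => (z != 0) && top_sources n off S true z.
have v0 : (v == 0) = false by rewrite /v; lia.
have X0 b : top_sources n off S b 0 = b by [].
have Xv b : top_sources n off S b v = ~~ b.
  by rewrite /top_sources v0 /v; case: b => /=; lia.
have Xz z : z != 0 -> z != v -> top_sources n off S false z = top_sources n off S true z.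
  by rewrite /top_sources /v => /negPf->; lia.
apply: (@matched_insert Z Z _ _ (fun=> True) _ 0 v) => //.
- exact: matched_refl.
- by rewrite /v; lia.
- by move=> z z0 zv; rewrite /Z z0 /= Xz.
- by move=> z z0 zv; rewrite Xz//; lia.
move=> F FF F1 _.
have Fz z : z != 0 -> z != v -> F z = false.
  by move=> z0 zv; apply/negP => /F1; rewrite Xz// eqxx.
have flipE b : flip (top_sources n off S b) F = top_sources n off S (b (+) F 0).
  apply: (@state_eq2 _ _ 0 v) => [||z z0 zv]; rewrite /flip ?X0 ?Xv -?FF//.
    by case: b; case: (F 0).
  by rewrite Fz// addbF; case: b; case: (F 0); rewrite ?Xz.
by rewrite !flipE !f0 addr0.
Qed.

Definition flags (e0 e1 e2 e3 : bool) : state := nth false [:: e0; e1; e2; e3].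

Lemma flags_eq (X : state) e0 e1 e2 e3 : X 0 = e0 -> X 1 = e1 -> X 2 = e2 -> X 3 = e3 ->
  (forall z, 3 < z -> X z = false) -> X = flags e0 e1 e2 e3.
Proof.
move=> h0 h1 h2 h3 h; apply: funext => -[|[|[|[|z]]]] //=.
by rewrite h// /flags nth_default.
Qed.

Lemma flip_flags e0 e1 e2 e3 b0 b1 b2 b3 :
  flip (flags e0 e1 e2 e3) (flags b0 b1 b2 b3) =
  flags (e0 (+) b0) (e1 (+) b1) (e2 (+) b2) (e3 (+) b3).
Proof. by apply: flags_eq => // z z3; rewrite /flip /flags !nth_default. Qed.

(** Complementary states differ at all four flags, and flag 0 is matched with 1 or with 3. Keeping
    the condition that an arc has opposite values at its ends allows one alternative to be excluded
    later. *)
Lemma complementary_pairing (R : realType) (f : state -> \bar R) e0 e1 e2 e3 :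
  exchangeable f ->
  f (flags e0 e1 e2 e3) != -oo%E ->
  f (flags (~~ e0) (~~ e1) (~~ e2) (~~ e3)) != -oo%E ->
  [\/ [/\ e0 != e1, e2 != e3 &
        (f (flags e0 e1 e2 e3) + f (flags (~~ e0) (~~ e1) (~~ e2) (~~ e3)) <=
         f (flags e0 e1 (~~ e2) (~~ e3)) + f (flags (~~ e0) (~~ e1) e2 e3))%E] |
      [/\ e0 != e3, e1 != e2 &
        (f (flags e0 e1 e2 e3) + f (flags (~~ e0) (~~ e1) (~~ e2) (~~ e3)) <=
         f (flags e0 (~~ e1) (~~ e2) e3) + f (flags (~~ e0) e1 e2 (~~ e3)))%E] ].
Proof.
move=> ex fX fY; have [pi m hP] := ex _ _ fX fY.
have [opp inv nc] := m.
set X := flags e0 e1 e2 e3 in fX m hP opp inv nc *.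
set Y := flags (~~ e0) (~~ e1) (~~ e2) (~~ e3) in fY m hP opp inv nc *.
have dE z : (X z != Y z) = (z < 4).
  case: z => [|[|[|[|z]]]]; rewrite /X /Y /flags /= ?nth_default//.
  - by case: e0 {X Y fX fY m hP opp inv nc}.
  - by case: e1 {X Y fX fY m hP opp inv nc}.
  - by case: e2 {X Y fX fY m hP opp inv nc}.
  - by case: e3 {X Y fX fY m hP opp inv nc}.
have piD z : z < 4 -> pi z < 4 by rewrite -!dE; apply: matching_diff.
have pine z : z < 4 -> pi z != z.
  move=> z4; have d : X z != Y z by rewrite dE.
  by apply/eqP => e; move: (d); have [] := opp z d; rewrite e => <-; rewrite eqxx.
have pine' z : z < 4 -> X z != X (pi z).
  move=> z4; have d : X z != Y z by rewrite dE.
  by have [-> _] := opp z d.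
have inv4 z : z < 4 -> pi (pi z) = z by move=> z4; apply: inv; rewrite dE.
have arc u v : u < 4 -> v < 4 -> pi u = v -> (f X + f Y <=
    f (flip X (fun z => (z == u) || (z == v))) + f (flip Y (fun z => (z == u) || (z == v))))%E.
  move=> u4 v4 uv; have vu : pi v = u by rewrite -uv inv4.
  apply: hP => z; rewrite ?dE; first by case/orP=> /eqP->.
  move=> z4; apply/idP/idP => [/orP[/eqP e|/eqP e]|/orP[/eqP->|/eqP->]].
  - by rewrite -(inv4 z)// e uv eqxx orbT.
  - by rewrite -(inv4 z)// e vu eqxx.
  - by rewrite uv eqxx orbT.
  - by rewrite vu eqxx.
have pidiff z t : z < 4 -> t < 4 -> z != t -> pi z != pi t.
  by move=> z4 t4; apply: contra => /eqP e; rewrite -(inv4 z)// e inv4.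
have := pine 0 isT; have := piD 0 isT; have p0 := inv4 0 isT.
have x0 := pine' 0 isT.
case E0 : (pi 0) p0 x0 => [|[|[|[|//]]]] // p0 x0 _ _.
- have : pi 2 = 3.
    have := pine 2 isT; have := piD 2 isT; have := pidiff 2 0 isT isT isT; have := pidiff 2 1 isT isT isT.
    by rewrite E0 p0; case: (pi 2) => [|[|[|[|]]]].
  move=> E2; left; have x2 := pine' 2 isT; rewrite E2 in x2.
  split=> //; have := arc 2 3 isT isT E2.
  have -> : (fun z => (z == 2) || (z == 3)) = flags false false true true.
    by apply: flags_eq => // -[|[|[|[|]]]].
  by rewrite /X /Y !flip_flags !addbF !addbT !negbK.
(* Matching 0 with 2 would force 1 to be matched with 3, and these arcs cross. *)
- have E1 : pi 1 = 3.
    have := pine 1 isT; have := piD 1 isT; have := pidiff 1 0 isT isT isT; have := pidiff 1 2 isT isT isT.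
    by rewrite E0 p0; case: (pi 1) => [|[|[|[|]]]].
  have := nc 0 1; rewrite !dE => /(_ isT isT isT); rewrite E0 E1.
  by move=> /(_ isT).
have E1 : pi 1 = 2.
  have := pine 1 isT; have := piD 1 isT; have := pidiff 1 0 isT isT isT; have := pidiff 1 3 isT isT isT.
  by rewrite E0 p0; case: (pi 1) => [|[|[|[|]]]].
right; have x1 := pine' 1 isT; rewrite E1 in x1.
split=> //; have := arc 1 2 isT isT E1.
have -> : (fun z => (z == 1) || (z == 2)) = flags false true true false.
  by apply: flags_eq => // -[|[|[|[|]]]].
by rewrite /X /Y !flip_flags !addbF !addbT !negbK.
Qed.

(** For the left-hand side both matchings are possible, whence the maximum. For each term on the
    right one matching would join flags of equal value, so the other one must occur, and it leads to
    the left-hand side. *)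
Lemma octahedron (R : realType) (f : state -> \bar R) : exchangeable f ->
  (f (flags true false true false) + f (flags false true false true) =
   maxe (f (flags true true false false) + f (flags false false true true))
        (f (flags false true true false) + f (flags true false false true)))%E.
Proof.
move=> ex.
have inf e0 e1 e2 e3 x :
    (f (flags e0 e1 e2 e3) != -oo%E -> f (flags (~~ e0) (~~ e1) (~~ e2) (~~ e3)) != -oo%E ->
     (f (flags e0 e1 e2 e3) + f (flags (~~ e0) (~~ e1) (~~ e2) (~~ e3)) <= x)%E) ->
    (f (flags e0 e1 e2 e3) + f (flags (~~ e0) (~~ e1) (~~ e2) (~~ e3)) <= x)%E.
  case: eqVneq => [->|_ h]; first by rewrite addNye leNye.
  by move: h; case: eqVneq => [->|_]; [rewrite addeNy leNye | apply].
apply/eqP; rewrite eq_le ge_max; apply/and3P; split.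
- apply: (inf true false true false) => f1 f2.
  have := complementary_pairing ex f1 f2.
  by rewrite le_max => -[[_ _ h]|[_ _ h]]; apply/orP; [right; rewrite [leRHS]addeC | left].
- apply: (inf true true false false) => f1 f2.
  by have := complementary_pairing ex f1 f2 => -[[]|[_ _]] //.
- rewrite addeC; apply: (inf true false false true) => f1 f2.
  by have := complementary_pairing ex f1 f2 => -[[_ _]|[]].
Qed.

(** * Elementary steps of the standard network *)

Lemma sorted_count_lt (T : eqType) (x0 : T) (t : T -> nat) (s : seq T) (m r : nat) :
  sorted ltn (map t s) -> r < size s ->
  (t (nth x0 s r) < m) = (r < count (fun x => t x < m) s).
Proof.
elim: s r => //= x s IHs r sxs rs.
have ss : sorted ltn (map t s) by move: sxs; case: (s) => //= y s' /andP[].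
have xs : all (fun y => t x < t y) s.
  have := order_path_min ltn_trans sxs; rewrite all_map.
  exact: sub_all.
case: r rs => [|r] rs /=.
  case: (ltnP (t x) m) => [_|mx] //=.
  rewrite add0n; apply/esym/negbTE; rewrite -leqNgt leqn0; apply/eqP.
  rewrite (@eq_in_count _ _ pred0) ?count_pred0// => y ys /=.
  by apply/negbTE; rewrite -leqNgt; apply: leq_trans mx _; apply/ltnW/(allP xs).
have IH := IHs r ss rs; rewrite IH.
case: (ltnP (t x) m) => [_|mx] /=; first by rewrite add1n ltnS.
have -> : count (fun y => t y < m) s = 0.
  rewrite (@eq_in_count _ _ pred0) ?count_pred0// => y ys /=.
  by apply/negbTE; rewrite -leqNgt; apply: leq_trans mx _; apply/ltnW/(allP xs).
by [].
Qed.

(* The index of the slanted edge a in the left to right enumeration of all the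
   slanted edges: column by column and, within a column, from top to bottom. *)
Definition slant_time (n : nat) (a : slanted n) : nat :=
  (val a).2 * n + (n.-1 - (val a).1).

Definition point_edge (n : nat) (p : attaching n) : slanted n :=
  match p with inl a => a | inr a => a end.

Definition lower_line (n : nat) (a : slanted n) : 'I_n :=
  Ordinal (leq_ltn_trans (leq_pred _) (ltn_ord (val a).1)).

Definition point_line (n : nat) (p : attaching n) : 'I_n :=
  match p with inl a => (val a).1 | inr a => lower_line a end.

Definition point_time (n : nat) (p : attaching n) : nat := slant_time (point_edge p).

Lemma lower_lineS n (a : slanted n) : (lower_line a).+1 = (val a).1.
Proof. by case: a => -[a b] /= ab; rewrite prednK// (leq_ltn_trans _ ab). Qed.

Lemma slant_time_lt n (a : slanted n) : slant_time a < n * n.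
Proof.
rewrite /slant_time; have := ltn_ord (val a).1; have := ltn_ord (val a).2.
move: (nat_of_ord _) (nat_of_ord _) => i l /=; nia.
Qed.

Lemma slant_time_inj n : injective (@slant_time n).
Proof.
move=> a b; rewrite /slant_time => e.
have {}e : (val a).1 = (val b).1 /\ (val a).2 = (val b).2.
  have := ltn_ord (val a).1; have := ltn_ord (val a).2.
  have := ltn_ord (val b).1; have := ltn_ord (val b).2 => h1 h2 h3 h4.
  have eq1 : (val a).2 = (val b).2 :> nat.
    move: e h1 h2 h3 h4.
    move: (nat_of_ord _) (nat_of_ord _) (nat_of_ord _) (nat_of_ord _) => i l i' l'.
    case: (ltngtP i i') => //; nia.
  split; apply: val_inj => //=.
  move: e h2 h4; rewrite eq1 => /addnI.
  by move: (nat_of_ord _) (nat_of_ord _) => x y; lia.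
apply: val_inj; case: e; case: (val a) (val b) => [? ?] [? ?] /=.
by move=> -> ->.
Qed.

Lemma slantE n (a : slanted n) l i :
  (slant n l i == Some a) = ((val a).1 == l :> nat) && ((val a).2 == i :> nat).
Proof.
rewrite /slant; case: pickP => [b /andP[/eqP b1 /eqP b2]|h]; last first.
  by rewrite h; apply/eqP.
apply/eqP/andP => [[<-]|[/eqP a1 /eqP a2]]; first by rewrite b1 b2.
congr Some; apply: val_inj; move: b1 b2; rewrite -a1 -a2.
case: (val a) (val b) => [? ?] [? ?] /= /ord_inj-> /ord_inj->.
by [].
Qed.

Lemma mem_line_points n l (p : attaching n) :
  (p \in line_points n l) = (point_line p == l :> nat).
Proof.
rewrite /line_points mem_pmap map_id; apply/flatten_mapP/eqP => [[i _]|<-].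
  rewrite !inE; case/orP.
    case E : slant => [b|//] /eqP[->] /=; move/eqP: E; rewrite slantE => /andP[/eqP e _].
    by rewrite e.
  by case E : slant => [b|//] /eqP[->] /=; move/eqP: E; rewrite slantE => /andP[/eqP e _].
exists (nat_of_ord (val (point_edge p)).2); first by rewrite mem_iota /=.
case: p => a /=; rewrite !inE; apply/orP.
  by right; rewrite (_ : slant _ _ _ = Some a) //; apply/eqP; rewrite slantE !eqxx.
left; rewrite (_ : slant _ _ _ = Some a) //; apply/eqP; rewrite slantE !eqxx andbT.
by rewrite -lower_lineS.
Qed.

(** The single numbering of the slanted edges is compatible with the order on every line at once;
    this is what lets the network be swept one slanted edge at a time. *)
Lemma sorted_line_points n l : sorted ltn (map (@point_time n) (line_points n l)).
Proof.
pose F i : seq (option (attaching n)) :=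
  [:: omap inr (slant n l.+1 i); omap inl (slant n l i)].
rewrite -[line_points n l]/(pmap id (flatten [seq F i | i <- iota 0 n])).
(* Induction on the number of columns left. The times of column [m] lie in the interval from [m * n]
   to [m * n + n] excluded, and the lower bound on the remaining columns allows one more to be put
   in front. *)
suff : forall k m, m + k = n -> 
    sorted ltn (map (@point_time n) (pmap id (flatten [seq F i | i <- iota m k]))) /\
    all (leq (m * n)) (map (@point_time n) (pmap id (flatten [seq F i | i <- iota m k]))).
  by move=> /(_ n 0); rewrite add0n => /(_ erefl)[].
elim=> [|k IHk] m mk //=; have := IHk m.+1; rewrite addSnnS => /(_ mk) [].
set s := map _ (pmap id (flatten _)) => srt /allP alls.
have tn t : t \in s -> m * n + n <= t.
  by move=> /alls; apply: leq_trans; rewrite mulSn addnC.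
have path_s t : t < m * n + n -> path ltn t s.
  rewrite path_sortedE; last exact: ltn_trans.
  by rewrite srt andbT => ht; apply/allP => t' /tn; apply: leq_trans.
have all_s : all (leq (m * n)) s.
  by apply/allP => t /tn; apply: leq_trans; rewrite leq_addr.
have tm (a : slanted n) l' : slant n l' m = Some a ->
    [/\ m * n <= slant_time a, slant_time a < m * n + n &
        slant_time a = m * n + (n.-1 - l') /\ l' < n].
  move/eqP; rewrite slantE => /andP[/eqP <- /eqP e]; rewrite /slant_time e.
  by have := ltn_ord (val a).1; move: (nat_of_ord _) => x xn; split; [lia|lia|split; lia].
case E1 : (slant n l.+1 m) => [a|] /=; case E2 : (slant n l m) => [b|] /=.
- have [a1 a2 [a3 a4]] := tm _ _ E1; have [b1 b2 [b3 b4]] := tm _ _ E2.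
  rewrite /point_time /= a1 b1 path_s// all_s; split=> //.
  by rewrite a3 b3 andbT ltn_add2l; lia.
- by have [a1 a2 _] := tm _ _ E1; rewrite /point_time /= a1 path_s.
- by have [a1 a2 _] := tm _ _ E2; rewrite /point_time /= a1 path_s.
- by [].
Qed.

Definition segment_rank n (m l : nat) : nat :=
  count (fun p : attaching n => point_time p < m) (line_points n l).

Lemma segment_rank_lt n m l : segment_rank n m l < (size (line_points n l)).+1.
Proof. by rewrite ltnS count_size. Qed.

(* The horizontal segment of line l just before the m-th slanted edge. *)
Definition segment n (m : nat) (l : 'I_n) : standard_edge n :=
  inr (existT (fun l : 'I_n => 'I_(size (line_points n l)).+1) l
         (Ordinal (segment_rank_lt n m l))).

(** A segment that reaches its sink ends at time [n * n], later than every attaching point. *)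
Definition end_time n (e : standard_edge n) : nat :=
  match standard_head e with inl p => point_time p | inr _ => n * n end.

Lemma point_time_lt n (p : attaching n) : point_time p < n * n.
Proof. exact: slant_time_lt. Qed.

Lemma headE n (l : 'I_n) (r : 'I_(size (line_points n l)).+1) (p0 : attaching n) :
  standard_head (inr (existT _ l r)) =
  if r < size (line_points n l) then inl (nth p0 (line_points n l) r) else inr l.
Proof.
rewrite /= nth_rcons size_map; case: ltnP => rs; first by rewrite (nth_map p0).
by case: eqVneq.
Qed.

Lemma segment_rank_end n m l : n * n <= m ->
  segment_rank n m l = size (line_points n l).
Proof.
move=> hm; apply/eqP; rewrite -all_count; apply/allP => p _.
exact: leq_trans (point_time_lt p) hm.
Qed.

Lemma segment_rankS n m l :
  segment_rank n m.+1 l = segment_rank n m l + (m \in map (@point_time n) (line_points n l)).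
Proof.
rewrite -count_uniq_mem; last first.
  by have := sorted_line_points n l; rewrite ltn_sorted_uniq_leq => /andP[].
rewrite count_map -count_predUI (@eq_count _ (predI _ _) pred0) ?count_pred0 ?addn0.
  by apply: eq_count => p /=; rewrite ltnS leq_eqVlt orbC.
by move=> p /=; apply/negbTE/negP => /andP[/ltn_eqF->].
Qed.

Lemma nth_point_lt n (p0 : attaching n) m l r : r < size (line_points n l) ->
  (point_time (nth p0 (line_points n l) r) < m) = (r < segment_rank n m l).
Proof. by apply: sorted_count_lt; apply: sorted_line_points. Qed.

(** A horizontal edge is determined by its line and its end time; so charging segments at their end
    times counts each of them once. *)
Lemma end_time_segment n (l : 'I_n) (r : 'I_(size (line_points n l)).+1) :
  inr (existT _ l r) = segment (end_time (inr (existT _ l r))) l :> standard_edge n.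
Proof.
congr (inr (existT _ _ _)); apply: val_inj => /=.
have p0E (s : seq (attaching n)) (i : nat) : i < size s -> attaching n by case: s.
have [rs|rs] := ltnP r (size (line_points n l)); last first.
  have e : r = size (line_points n l) :> nat.
    by apply/eqP; rewrite eqn_leq rs -ltnS ltn_ord.
  rewrite segment_rank_end// /end_time /= e nth_rcons size_map ltnn eqxx.
  exact: leqnn.
have p0 := p0E _ _ rs; rewrite /end_time (headE _ p0) rs; set t := point_time _.
have := nth_point_lt p0 t rs; have := nth_point_lt p0 t.+1 rs.
rewrite -/t ltnn leqnn segment_rankS => /esym h1 /esym/negbT; rewrite -leqNgt => h2.
apply/eqP; rewrite eqn_leq h2 andbT.
by move: h1; case: (_ \in _); rewrite ?addn1 ?addn0 ?ltnS//; apply: ltnW.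
Qed.

Lemma end_time_le n (e : standard_edge n) : end_time e <= n * n.
Proof. by rewrite /end_time; case: standard_head => // p; apply/ltnW/point_time_lt. Qed.

Lemma segment_stay n m (l : 'I_n) : m < n * n -> end_time (segment m l) != m ->
  segment m.+1 l = segment m l.
Proof.
move=> mn h; congr (inr (existT _ _ _)); apply: val_inj => /=.
rewrite segment_rankS; case: mapP => [[p pl e]|_]; last by rewrite addn0.
have ip : index p (line_points n l) < size (line_points n l) by rewrite index_mem.
case/negP: h; rewrite /end_time (headE _ p) /=.
have := nth_point_lt p m ip; have := nth_point_lt p m.+1 ip.
rewrite nth_index// -e ltnn leqnn segment_rankS.
have -> : m \in map (@point_time n) (line_points n l) by apply/mapP; exists p.
rewrite addn1 ltnS => /esym h1 /esym/negbT; rewrite -leqNgt => h2.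
have -> : segment_rank n m l = index p (line_points n l) by apply/eqP; rewrite eqn_leq h1 h2.
by rewrite ip nth_index// e.
Qed.

Lemma segment_rank_point n (p : attaching n) :
  segment_rank n (point_time p) (point_line p) = index p (line_points n (point_line p)) /\
  segment_rank n (point_time p).+1 (point_line p) =
    (index p (line_points n (point_line p))).+1.
Proof.
have pl : p \in line_points n (point_line p) by rewrite mem_line_points.
set s := line_points _ _ in pl *; have ip : index p s < size s by rewrite index_mem.
have := nth_point_lt p (point_time p) ip; have := nth_point_lt p (point_time p).+1 ip.
rewrite nth_index// ltnn leqnn segment_rankS.
have -> : point_time p \in map (@point_time n) s by apply/mapP; exists p.
rewrite addn1 ltnS => /esym h1 /esym/negbT; rewrite -leqNgt => h2.
suff -> : segment_rank n (point_time p) (point_line p) = index p s by [].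
by apply/eqP; rewrite eqn_leq h1 h2.
Qed.

Lemma head_segment n (p : attaching n) :
  standard_head (segment (point_time p) (point_line p)) = inl p.
Proof.
rewrite (headE _ p) /= (segment_rank_point p).1 index_mem mem_line_points eqxx.
by rewrite nth_index// mem_line_points.
Qed.

Lemma tail_segment n (p : attaching n) :
  standard_tail (segment (point_time p).+1 (point_line p)) = inr p.
Proof.
rewrite /= (segment_rank_point p).2 /= (nth_map p) ?index_mem ?mem_line_points//.
by rewrite nth_index// mem_line_points.
Qed.

Lemma end_time_point n (p : attaching n) :
  end_time (segment (point_time p) (point_line p)) = point_time p.
Proof. by rewrite /end_time head_segment. Qed.

Lemma tail_segment0 n (l : 'I_n) : standard_tail (segment 0 l) = inl l.
Proof. by rewrite /= /segment_rank (eq_count (a2 := pred0)) ?count_pred0. Qed.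

Lemma head_segment_end n (l : 'I_n) : standard_head (segment (n * n) l) = inr l.
Proof. by rewrite /= segment_rank_end// nth_rcons size_map ltnn eqxx. Qed.

Lemma head_sink n (e : standard_edge n) l :
  standard_head e = inr l -> e = segment (n * n) l.
Proof.
case: e => [//|[l' r]] h; have : end_time (inr (existT _ l' r) : standard_edge n) = n * n.
  by rewrite /end_time h.
move=> ht; rewrite end_time_segment ht; congr segment.
have := head_segment_end l'; rewrite -ht -end_time_segment h; by case.
Qed.

Lemma head_point n (e : standard_edge n) p : standard_head e = inl p ->
  e = segment (point_time p) (point_line p) \/ exists2 a, e = inl a & p = inr a.
Proof.
case: e => [a [<-]|[l r] h]; first by right; exists a.
have : end_time (inr (existT _ l r) : standard_edge n) = point_time p.
  by rewrite /end_time h.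
move=> ht; left; rewrite end_time_segment ht; congr segment.
have p0 := p; move: h; rewrite (headE _ p0); case: ltnP => // rs [<-].
apply: val_inj; apply/eqP; rewrite eq_sym -mem_line_points; exact: mem_nth.
Qed.

Lemma tailE n (l : 'I_n) (r : 'I_(size (line_points n l)).+1) (p0 : attaching n) :
  standard_tail (inr (existT _ l r)) =
  if nat_of_ord r is r'.+1 then inr (nth p0 (line_points n l) r') else inl l.
Proof.
case: r => -[//|r] /=; rewrite ltnS => h; exact: (nth_map p0).
Qed.

Lemma tail_source n (e : standard_edge n) l :
  standard_tail e = inl l -> e = segment 0 l.
Proof.
case: e => [//|[l' r] h]; have re : r = 0 :> nat /\ l' = l.
  move: h; case: r => -[|r] h; first by case.
  have p0E (s : seq (attaching n)) (i : nat) : i.+1 < (size s).+1 -> attaching n by case: s.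
  have p0 := p0E _ _ h.
  by rewrite (tailE _ p0).
case: re => re <-; congr (inr (existT _ _ _)); apply: val_inj => /=.
by rewrite re /segment_rank (eq_count (a2 := pred0)) ?count_pred0.
Qed.

Lemma tail_point n (e : standard_edge n) p : standard_tail e = inr p ->
  e = segment (point_time p).+1 (point_line p) \/ exists2 a, e = inl a & p = inl a.
Proof.
case: e => [a [<-]|[l r] h]; first by right; exists a.
left; move: h; rewrite (tailE _ p); case: r => -[//|r] /= rs [e].
have pl : p \in line_points n l by rewrite -e mem_nth.
have el : l = point_line p by apply/val_inj/esym/eqP; rewrite -mem_line_points.
subst l; congr (inr (existT _ _ _)); apply: val_inj => /=.
have us : uniq (line_points n (point_line p)).
  by have := sorted_line_points n (point_line p); rewrite ltn_sorted_uniq_leq => /andP[/map_uniq].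
have := index_uniq p (rs : r < size _) us; rewrite e => ir.
by rewrite (segment_rank_point p).2 ir.
Qed.

Lemma end_time_point_exists n m (l : 'I_n) : m < n * n -> end_time (segment m l) = m ->
  exists p, [/\ point_line p = l, point_time p = m & standard_head (segment m l) = inl p].
Proof.
move=> mn; rewrite /end_time; case E : standard_head => [p|l']; last by lia.
move=> ht; exists p; split=> //.
by have [[] //|[a //]] := head_point E.
Qed.

(** * The recursion and families of partial paths *)

(** A segment is charged when it ends, not while it is being followed, so a long segment is not
    counted repeatedly. *)
Definition segment_weight (R : realType) n (w : standard_edge n -> \bar R) (m : nat)
    (l : 'I_n) : \bar R :=
  if end_time (segment m l) == m then w (segment m l) else 0%E.

(** Some times below [n * n] belong to no slanted edge; no segment ends at them either, so such a
    step adds nothing. *)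
Definition edge_step (R : realType) n (off : nat) (w : standard_edge n -> \bar R)
    (m : nat) (f : state -> \bar R) : state -> \bar R :=
  let g := add_weights off (segment_weight w m) f in
  if [pick a | slant_time a == m] is Some a
  then step_down (off + lower_line a) (w (inl a)) g else g.

Fixpoint edge_steps (R : realType) n (off : nat) (w : standard_edge n -> \bar R)
    (f : state -> \bar R) (m : nat) : state -> \bar R :=
  if m is m'.+1 then edge_step off w m' (edge_steps off w f m') else f.

Definition block (R : realType) n (off : nat) (w : standard_edge n -> \bar R)
    (f : state -> \bar R) : state -> \bar R :=
  add_weights off (segment_weight w (n * n)) (edge_steps off w f (n * n)).

(** The exchange property is proved for [lo = 0], where the lowest paths stop. A general [lo] serves
    for the finiteness of m, where the paths follow prescribed lines. *)
Fixpoint blocks (R : realType) n (off : nat) (w : nat -> standard_edge n -> \bar R)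
    (lo hi : nat -> nat) (f : state -> \bar R) (j : nat) : state -> \bar R :=
  if j is i.+1
  then freeze i.+1 (off + lo i) (off + hi i) (block off (w i) (blocks off w lo hi f i))
  else f.

Lemma exchangeable_edge_steps (R : realType) n off (w : standard_edge n -> \bar R) f m :
  exchangeable f -> exchangeable (edge_steps off w f m).
Proof.
move=> ex; elim: m => //= m IHm; rewrite /edge_step; case: pickP => [a _|_].
  exact/exchangeable_step_down/exchangeable_add_weights.
exact: exchangeable_add_weights.
Qed.

Lemma unset_edge_steps (R : realType) n a off (w : standard_edge n -> \bar R) f m :
  unset a off f -> unset a off (edge_steps off w f m).
Proof.
move=> uf; elim: m => //= m IHm; rewrite /edge_step; case: pickP => [b _|_].
  by apply: unset_step_down; [rewrite leq_addr | exact: unset_add_weights].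
exact: unset_add_weights.
Qed.

Lemma exchangeable_blocks (R : realType) n off (w : nat -> standard_edge n -> \bar R) hi f j :
  j < off -> unset 1 off f -> exchangeable f ->
  exchangeable (blocks off w (fun=> 0) hi f j) /\
  unset j.+1 off (blocks off w (fun=> 0) hi f j).
Proof.
move=> joff uf ex; elim: j joff => //= j IHj joff.
have [exj uj] := IHj (ltnW joff).
have uj' : unset j.+1 off (block off (w j) (blocks off w (fun=> 0) hi f j)).
  exact/unset_add_weights/unset_edge_steps.
split; rewrite addn0; last by apply: unset_freeze; rewrite ?leq_addr.
apply: exchangeable_freeze; rewrite ?leq_addr//.
exact/exchangeable_add_weights/exchangeable_edge_steps.
Qed.

(** * Families of partial paths in a composite of standard networks *)

Definition stack (n K : nat) : 'I_K.+1 -> network n := fun=> standard n.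

(** Networks are indexed by natural numbers, through [inord], so that the recursion can run over
    them without dependent ordinals; hence the hypotheses [j <= K]. *)
Definition at_block n K (j : nat) (e : standard_edge n) : cedge (stack n (K := K)) :=
  existT (fun i : 'I_K.+1 => edge (stack n i)) (inord j) e.

Definition vertex_at n K (j : nat) (p : attaching n) : cvertex (stack n (K := K)) :=
  @inside n K.+1 (stack n (K := K)) (inord j) p.

Lemma ctail_at n K j (e : standard_edge n) : j <= K ->
  ctail (at_block K j e) = match standard_tail e with
    | inl i => boundary (stack n (K := K)) (inord j) i | inr p => vertex_at K j p end.
Proof.
move=> jK; rewrite /ctail /= -/(standard_tail e); case: standard_tail => // i.
congr (boundary _ _ _); apply: val_inj => /=; rewrite !inordK//.
exact: leqW.
Qed.

Lemma chead_at n K j (e : standard_edge n) : j <= K ->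
  chead (at_block K j e) = match standard_head e with
    | inr i => boundary (stack n (K := K)) (inord j.+1) i | inl p => vertex_at K j p end.
Proof.
move=> jK; rewrite /chead /= -/(standard_head e); case: standard_head => // i.
by congr (boundary _ _ _); apply: val_inj; rewrite /= /bump /= !inordK.
Qed.

(** The time at which the sweep meets a vertex: each network takes [(n * n).+1] units. The two ends
    of a slanted edge have the same rank. *)
Definition vertex_rank n K (v : cvertex (stack n (K := K))) : nat :=
  match v with
  | inl (b, _) => b * (n * n).+1
  | inr (existT j p) => j * (n * n).+1 + (@point_time n p).+1
  end.

Lemma rank_boundary n K b i : b <= K.+1 ->
  vertex_rank (boundary (stack n (K := K)) (inord b) i) = b * (n * n).+1.
Proof. by move=> bK; rewrite /= inordK. Qed.

Lemma rank_vertex_at n K j p : j <= K ->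
  vertex_rank (@vertex_at n K j p) = j * (n * n).+1 + (point_time p).+1.
Proof. by move=> bK; rewrite /= inordK. Qed.

(* A path is labelled (0, l) while it is on its way along the line l, and (b.+1, l) once
   it has stopped at the sink l of the b-th network. *)
Definition labelled n K := (nat * 'I_n * cpath (stack n (K := K)))%type.

(** [fam_rank] is the device for disjointness: vertices met so far have rank at most [clock], and
    all those added next have a larger one. *)
Record path_family n K (J : nat) (cur : 'I_n -> cvertex (stack n (K := K))) (clock : nat)
    (labels : pred (nat * 'I_n)) (fam : seq (labelled n K)) : Prop := PathFamily {
  fam_uniq : uniq (map fst fam);
  fam_labels : map fst fam =i labels;
  fam_disjoint : uniq (flatten [seq vertices x.2 | x <- fam]);
  fam_rank : forall (x : labelled n K) v, x \in fam -> v \in vertices x.2 -> vertex_rank v <= clock;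
  fam_walk : forall x : labelled n K, x \in fam -> walk (start x.2) x.2.2;
  fam_live : forall x : labelled n K, x \in fam -> x.1.1 = 0 ->
    finish x.2 = cur x.1.2 /\ all (fun e : cedge (stack n (K := K)) => tag e < J) x.2.2;
  fam_stopped : forall (x : labelled n K) b, x \in fam -> x.1.1 = b.+1 ->
    b <= K /\ is_path_upto (inord b) x.2
}.

Definition family_weight (R : realType) n K
  (w : forall j : 'I_K.+1, weighting R (stack n j)) (fam : seq (labelled n K)) : \bar R :=
  (\sum_(x <- fam) \sum_(e <- x.2.2) cweight w e)%E.

Definition extend_path n K (ext : nat * 'I_n -> seq (cedge (stack n (K := K))))
    (phi : nat * 'I_n -> nat * 'I_n) (x : labelled n K) : labelled n K :=
  (phi x.1, (x.2.1, x.2.2 ++ ext x.1)).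

Lemma walk_cat n k (N : 'I_k -> network n) (v : cvertex N) s1 s2 :
  walk v (s1 ++ s2) = walk v s1 && walk (last v (map (@chead n k N) s1)) s2.
Proof. by elim: s1 v => //= e s1 IHs v; rewrite IHs andbA. Qed.

Lemma uniq_flatten_cat (T U : eqType) (s : seq T) (f g : T -> seq U) (P : pred U) :
  uniq (flatten (map f s)) -> uniq (flatten (map g s)) ->
  (forall x v, x \in s -> v \in f x -> P v) ->
  (forall x v, x \in s -> v \in g x -> ~~ P v) ->
  uniq (flatten [seq f x ++ g x | x <- s]).
Proof.
move=> uf ug Pf Pg.
have : perm_eq (flatten [seq f x ++ g x | x <- s]) (flatten (map f s) ++ flatten (map g s)).
  elim: s {uf ug Pf Pg} => //= x s IHs.
  by rewrite perm_sym perm_catACA perm_cat2l perm_sym.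
move/perm_uniq->; rewrite cat_uniq uf ug andbT; apply/hasPn => v /flatten_mapP[x xs vx].
apply/flatten_mapP => -[y ys vy]; have := Pg _ _ xs vx.
by rewrite (Pf _ _ ys vy).
Qed.

(** This covers the three kinds of progress: walking along segments, moving down, and stopping.
    [ext] gives the appended edges and [phi] the new labels. By rank the new vertices differ from
    the old ones, so only collisions among new vertices have to be excluded. *)
Lemma extend_family n K J J' cur cur' clock clock' labels (labels' : pred (nat * 'I_n)) fam
    (ext : nat * 'I_n -> seq (cedge (stack n (K := K)))) (phi : nat * 'I_n -> nat * 'I_n) :
  @path_family n K J cur clock labels fam ->
  J <= J' -> clock <= clock' ->
  (forall k k', labels k -> labels k' -> phi k = phi k' -> k = k') ->
  (forall k', labels' k' <-> exists2 k, labels k & phi k = k') ->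
  (forall b l, ext (b.+1, l) = [::] /\ phi (b.+1, l) = (b.+1, l)) ->
  (forall l, labels (0, l) ->
     [/\ walk (cur l) (ext (0, l)), all (fun e : cedge (stack n (K := K)) => tag e < J') (ext (0, l)),
         forall e, e \in ext (0, l) -> clock < vertex_rank (chead e) <= clock' &
         uniq (map (@chead n K.+1 (stack n (K := K))) (ext (0, l)))]) ->
  (forall l l', labels (0, l) -> labels (0, l') -> l != l' -> forall e e',
     e \in ext (0, l) -> e' \in ext (0, l') -> chead e != chead e') ->
  (forall l, labels (0, l) ->
     let v := last (cur l) (map (@chead n K.+1 (stack n (K := K))) (ext (0, l))) in
     match phi (0, l) with
     | (0, l') => v = cur' l'
     | (b.+1, _) => [/\ b <= K, J' <= b.+1 & exists t, v = boundary _ (lift ord0 (inord b)) t]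
     end) ->
  path_family J' cur' clock' labels' (map (extend_path ext phi) fam).
Proof.
move=> [fu fl fd fr fw fv fs] JJ cc phi_inj lab' frozen live disj fin.
have lab x : x \in fam -> labels x.1 by move=> xf; have := map_f fst xf; rewrite fl.
have mapE : map fst (map (extend_path ext phi) fam) = map phi (map fst fam).
  by rewrite -!map_comp.
have extE x e : x \in fam -> e \in ext x.1 -> x.1.1 = 0 /\ labels (0, x.1.2).
  move=> xf; have := lab _ xf; case: x xf => [[[|b] l] x] //= _ _.
  by rewrite (frozen b l).1.
have vertE x : vertices (extend_path ext phi x).2 =
    vertices x.2 ++ map (@chead n K.+1 (stack n (K := K))) (ext x.1).
  by rewrite /vertices /= map_cat.
split.
- rewrite mapE map_inj_in_uniq// => k k'; rewrite !fl => h h'; exact: phi_inj.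
- move=> k'; rewrite mapE; apply/mapP/idP => [[k]|/lab'[k h1 h2]].
    by rewrite fl => h ->; apply/lab'; exists k.
  by exists k; rewrite ?fl.
- have new_rank x v : x \in fam -> v \in map (@chead n K.+1 (stack n (K := K))) (ext x.1) ->
      clock < vertex_rank v.
    move=> xf /mapP[e ex ->]; have [x0 xl] := extE _ _ xf ex.
    have [_ _ h _] := live _ xl; move: ex; rewrite (surjective_pairing x.1) x0 => /h.
    by case/andP.
  have : uniq (flatten [seq map (@chead n K.+1 (stack n (K := K))) (ext x.1) | x <- fam]).
    move: (lab) (extE) (fu); clear -live disj.
    elim: fam => //= x fam IHfam lab extE /andP[xn fu].
    rewrite cat_uniq; apply/and3P; split.
    + case E : (ext x.1) => [//|e s].
      have [x0 xl] : x.1.1 = 0 /\ labels (0, x.1.2).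
        by apply: (extE x e); rewrite ?mem_head// E mem_head.
      have [_ _ _] := live _ xl; rewrite -E (surjective_pairing x.1) x0.
      by [].
    + apply/hasPn => v /flatten_mapP[y yf /mapP[e ey ->]].
      apply/mapP => -[e' ex].
      have [y0 yl] : y.1.1 = 0 /\ labels (0, y.1.2).
        by apply: (extE y e); rewrite // inE yf orbT.
      have [x0 xl] : x.1.1 = 0 /\ labels (0, x.1.2).
        by apply: (extE x e'); rewrite ?mem_head.
      have xy : y.1.2 != x.1.2.
        apply: contra xn => /eqP e2; apply/mapP; exists y => //.
        by rewrite (surjective_pairing x.1) x0 -e2 -y0 -surjective_pairing.
      move: ey ex; rewrite (surjective_pairing x.1) (surjective_pairing y.1) x0 y0 => ey ex.
      by apply/eqP; apply: (disj _ _ yl xl xy).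
    + apply: IHfam => // [y yf|y e' yf]; first by apply: lab; rewrite inE yf orbT.
      by apply: extE; rewrite inE yf orbT.
  move=> nd; rewrite -map_comp (eq_map (g := fun x : labelled n K => vertices x.2 ++
    map (@chead n K.+1 (stack n (K := K))) (ext x.1))); last exact: vertE.
  apply: (@uniq_flatten_cat _ _ _ _ _ (fun v => vertex_rank v <= clock)) => // x v xf vx.
  by rewrite -ltnNge; exact: (new_rank _ _ xf vx).
- move=> _ v /mapP[x xf ->]; rewrite vertE mem_cat => /orP[vx|/mapP[e ex ->]].
    exact: leq_trans (fr _ _ xf vx) cc.
  have [x0 xl] := extE _ _ xf ex; have [_ _ h _] := live _ xl.
  by move: ex; rewrite (surjective_pairing x.1) x0 => /h /andP[].
- move=> _ /mapP[x xf ->]; rewrite /extend_path /= walk_cat.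
  rewrite -[start _]/(start x.2) fw//=; have := fv _ xf; have := lab _ xf.
  case: x xf => [[[|b] l] x] /= xf; last by rewrite (frozen b l).1.
  by rewrite /finish => xl /(_ erefl)[-> _]; have [] := live _ xl.
- move=> _ /mapP[x xf ->] /=; have := fv _ xf; have := lab _ xf.
  case: x xf => [[[|b] l] x] /= xf; last by rewrite (frozen b l).2.
  move=> xl /(_ erefl)[e1 e2]; have := fin _ xl; have [_ h2 _ _] := live _ xl.
  case: (phi (0, l)) => -[|b] l' /= eqv // _.
  rewrite /finish /= map_cat last_cat -/(start x) -/(finish x) e1; split=> //.
  by rewrite all_cat h2 andbT; apply: sub_all e2 => e he; apply: leq_trans he JJ.
- move=> _ b /mapP[x xf ->] /=; have := fv _ xf; have := lab _ xf; have := fs x _ xf; have := fw _ xf.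
  case: x xf => [[[|b'] l] x] /= xf xw.
    move=> _ xl /(_ erefl)[e1 e2]; have := fin _ xl; have [h1 h2 _ _] := live _ xl.
    case: (phi (0, l)) => -[|b0] l' //= [bK Jb ht] [<-]; split=> //; split.
    + by rewrite /= walk_cat xw /= -/(finish x) -/(start x) e1.
    + rewrite /= all_cat; apply/andP; split.
        apply: sub_all e2 => e he; rewrite inordK// -ltnS.
        by apply: leq_trans he _; apply: leq_trans Jb.
      apply: sub_all h2 => e he; rewrite inordK// -ltnS.
      exact: leq_trans he Jb.
    + case: ht => t ht; exists t; rewrite /finish /= map_cat last_cat.
      by rewrite -/(start x) -/(finish x) e1.
  move=> /(_ b' erefl)[bK bp] _ _; rewrite (frozen b' l).2 /= => -[<-].
  by rewrite (frozen b' l).1 cats0 -surjective_pairing.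
Qed.

Lemma extend_family_weight (R : realType) n K
    (w : forall j : 'I_K.+1, weighting R (stack n j)) fam ext phi :
  (family_weight w (map (extend_path ext phi) fam) =
   family_weight w fam + \sum_(k <- map fst fam) \sum_(e <- ext k) cweight w e)%E.
Proof.
rewrite /family_weight !big_map -big_split /=; apply: eq_bigr => x _.
by rewrite big_cat.
Qed.

Definition labels_of n off (lo hi : nat -> nat) (j : nat) (X : state) : pred (nat * 'I_n) :=
  fun k => if k.1 is b.+1 then (b < j) && (lo b <= k.2 < hi b + X b.+1) else X (off + k.2).

Lemma sum_labels (R : realType) n off lo hi j X (ks : seq (nat * 'I_n))
    (G : nat * 'I_n -> \bar R) :
  uniq ks -> ks =i labels_of off lo hi j X -> (forall b l, G (b.+1, l) = 0%E) ->
  (\sum_(k <- ks) G k = \sum_(l < n) (if X (off + l)%N then G (0%N, l) else 0))%E.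
Proof.
move=> uks ksE G0; rewrite (bigID (fun k => k.1 == 0)) /= [X in (_ + X)%E]big1 ?adde0; last first.
  by case=> -[|b] l //= _; rewrite G0.
rewrite -big_filter -big_mkcond -[RHS]big_filter -(big_map (fun l : 'I_n => (0, l)) predT G).
apply: perm_big; apply: uniq_perm.
- exact: filter_uniq.
- by rewrite map_inj_uniq ?filter_uniq ?index_enum_uniq// => l l' [].
case=> b l; rewrite mem_filter ksE; apply/andP/mapP => /= [[/eqP-> h]|[l' + [-> ->]]].
  by exists l => //; rewrite mem_filter mem_index_enum andbT.
by rewrite mem_filter => /andP[h _]; split.
Qed.

Lemma segment_line n m m' (l l' : 'I_n) : segment m l = segment m' l' -> l = l'.
Proof. by case. Qed.

Lemma head_segment_inj n m (l l' : 'I_n) : end_time (segment m l) = m ->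
  standard_head (segment m l) = standard_head (segment m l') -> l = l'.
Proof.
case E : (standard_head (segment m l)) => [p|i] _ /esym E'.
  have [/segment_line->|[a //]] := head_point E.
  by have [/segment_line->|[a //]] := head_point E'.
by rewrite (segment_line (head_sink E)) (segment_line (head_sink E')).
Qed.

(** * Realising the values of the recursion by families of paths *)

Definition vertex_now n K (j m : nat) (l : 'I_n) : cvertex (stack n (K := K)) :=
  ctail (at_block K j (segment m l)).

(** A path waits at the tail of its segment until the segment ends. This is its position after the
    segments of time [m] have been walked, but before the slanted edge. *)
Definition vertex_next n K (j m : nat) (l : 'I_n) : cvertex (stack n (K := K)) :=
  if end_time (segment m l) == m then chead (at_block K j (segment m l))
  else vertex_now K j m l.

Lemma vertex_nextE n K j m (l : 'I_n) : j <= K -> m < n * n ->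
  vertex_next K j m l = vertex_now K j m.+1 l.
Proof.
move=> jK mn; rewrite /vertex_next /vertex_now; case: eqVneq => [e|ne]; last first.
  by rewrite (segment_stay mn ne).
have [p [<- <- h]] := end_time_point_exists mn e.
by rewrite ctail_at// chead_at// head_segment tail_segment.
Qed.

Lemma vertex_next_end n K j (l : 'I_n) : j <= K ->
  vertex_next K j (n * n) l = boundary (stack n (K := K)) (inord j.+1) l.
Proof.
by move=> jK; rewrite /vertex_next {1}/end_time head_segment_end eqxx chead_at// head_segment_end.
Qed.

Lemma vertex_now0 n K j (l : 'I_n) : j <= K ->
  vertex_now K j 0 l = boundary (stack n (K := K)) (inord j) l.
Proof. by move=> jK; rewrite /vertex_now ctail_at// tail_segment0. Qed.

Lemma rank_chead_segment n K j m (l : 'I_n) : j <= K -> end_time (segment m l) = m ->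
  vertex_rank (chead (at_block K j (segment m l))) = j * (n * n).+1 + m.+1.
Proof.
move=> jK; rewrite chead_at// /end_time; case: standard_head => [p <-|i <-].
  by rewrite rank_vertex_at.
by rewrite rank_boundary// mulSn addnC.
Qed.

Definition reachable (R : realType) n K (w : forall j : 'I_K.+1, weighting R (stack n j))
    (lo hi : nat -> nat) (j J : nat) cur clock (X : state) (c : \bar R) : Prop :=
  exists2 fam, @path_family n K J cur clock (labels_of K.+2 lo hi j X) fam &
               family_weight w fam = c.

Definition block_weight (R : realType) n K (w : forall j : 'I_K.+1, weighting R (stack n j))
  (j : nat) (e : standard_edge n) : \bar R := cweight w (at_block K j e).

Lemma at_block_inj n K j : injective (@at_block n K j).
Proof. by move=> e e' /eqP; rewrite eq_Tagged => /eqP. Qed.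

Lemma vertex_at_inj n K j : injective (@vertex_at n K j).
Proof.
move=> p p' h.
pose q := Tagged (fun i : 'I_K.+1 => inner (stack n i)) (p : inner (stack n (inord j))).
have /eqP := congr1 (fun v : cvertex (stack n (K := K)) => if v is inr t then t else q) h.
by rewrite /q /vertex_at /inside /= eq_Tagged => /eqP.
Qed.

Lemma reachable_segments (R : realType) n K (w : forall j : 'I_K.+1, weighting R (stack n j))
    lo hi j J m X c :
  j <= K -> J <= j.+1 ->
  reachable w lo hi j J (vertex_now K j m) (j * (n * n).+1 + m) X c ->
  reachable w lo hi j j.+1 (vertex_next K j m) (j * (n * n).+1 + m.+1) X
    (c + \sum_(l < n) (if X (K.+2 + l)%N then segment_weight (block_weight w j) m l else 0))%E.
Proof.
move=> jK Jj [fam ff fw].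
pose ext (k : nat * 'I_n) : seq (cedge (stack n (K := K))) :=
  if (k.1 == 0) && (end_time (segment m k.2) == m) then [:: at_block K j (segment m k.2)] else [::].
exists (map (extend_path ext id) fam); last first.
  rewrite extend_family_weight fw; congr (_ + _)%E.
  rewrite (sum_labels (fam_uniq ff) (fam_labels ff)); last by move=> b l; rewrite /ext big_nil.
  apply: eq_bigr => l _; case: (X _) => //; rewrite /ext /segment_weight /=.
  by case: ifP => _; rewrite ?big_seq1 ?big_nil.
apply: (extend_family ff) => //.
- by rewrite leq_add2l.
- by move=> k'; split=> [h|[k h <-]] //; exists k'.
- move=> l _; rewrite /ext /=; case: eqP => [e|_] //=; split=> //.
  + by rewrite eqxx.
  + by rewrite inordK// ltnSn.
  + by move=> e'; rewrite inE => /eqP->; rewrite rank_chead_segment// ltn_add2l !leqnn.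
- move=> l l' _ _ ll' e e'; rewrite /ext /=; case: eqP => // h1; case: eqP => // h2.
  rewrite !inE => /eqP-> /eqP->; apply: contra ll' => /eqP; rewrite !chead_at//.
  move=> h; apply/eqP/(head_segment_inj h1).
  case: standard_head h => [p|i]; case: standard_head => [p'|i'] //.
    by move/vertex_at_inj->.
  by move=> [->].
move=> l _; rewrite /ext /= /vertex_next /vertex_now.
by case: eqP.
Qed.

(** Only the path on the upper line walks: along its segment to the start of [a], then along [a].
    The lower line also has a segment ending at this time, but it is unoccupied in [X0]. *)
Lemma reachable_down (R : realType) n K (w : forall j : 'I_K.+1, weighting R (stack n j))
    lo hi j J (a : slanted n) (X : state) c :
  let m := slant_time a in let q := K.+2 + lower_line a in
  let X0 := X \o transp q q.+1 in
  j <= K -> J <= j.+1 -> X q -> ~~ X q.+1 ->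
  reachable w lo hi j J (vertex_now K j m) (j * (n * n).+1 + m) X0 c ->
  reachable w lo hi j j.+1 (vertex_now K j m.+1) (j * (n * n).+1 + m.+1) X
    (c + \sum_(l < n) (if X0 (K.+2 + l)%N then segment_weight (block_weight w j) m l else 0)
       + block_weight w j (inl a))%E.
Proof.
move=> m q X0 jK Jj Xq Xq1 [fam ff fw].
have mn : m < n * n by apply: slant_time_lt.
have qS : q.+1 = K.+2 + (val a).1 by rewrite -lower_lineS addnS.
have X0q : X0 q = false by rewrite /X0 /= transpl (negbTE Xq1).
have X0q1 : X0 q.+1 by rewrite /X0 /= transpr.
have low_up : lower_line a != (val a).1.
  by apply/eqP => e; have := lower_lineS a; rewrite e; lia.
have X0z z : z != q -> z != q.+1 -> X0 z = X z by move=> z1 z2; rewrite /X0 /= transp_id.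
have lq (l : 'I_n) : (K.+2 + l == q) = (l == lower_line a) by rewrite eqn_add2l.
have lq1 (l : 'I_n) : (K.+2 + l == q.+1) = (l == (val a).1) by rewrite qS eqn_add2l.
have end_up : end_time (segment m (val a).1) = m by rewrite -[RHS]/(point_time (inl a)) -end_time_point.
have end_other l : l != (val a).1 -> l != lower_line a -> end_time (segment m l) != m.
  move=> l1 l2; apply/eqP => /(end_time_point_exists mn)[p [pl pt _]].
  have ea : point_edge p = a by apply: slant_time_inj.
  by case: p pl pt ea l1 l2 => b /= <- _ ->; rewrite eqxx.
have head_up : standard_head (segment m (val a).1) = inl (inl a).
  exact: (head_segment (inl a)).
pose ext (k : nat * 'I_n) : seq (cedge (stack n (K := K))) :=
  if (k.1 == 0) && (k.2 == (val a).1)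
  then [:: at_block K j (segment m k.2); at_block K j (inl a)] else [::].
pose phi (k : nat * 'I_n) := if k == (0, (val a).1) then (0, lower_line a) else k.
have lab0 l : labels_of K.+2 lo hi j X0 (0, l) -> l != lower_line a.
  by rewrite /labels_of /=; apply: contraTneq => ->; rewrite -/q X0q.
exists (map (extend_path ext phi) fam); last first.
  rewrite extend_family_weight fw -addeA; congr (_ + _)%E.
  rewrite (sum_labels (fam_uniq ff) (fam_labels ff)); last by move=> b l; rewrite /ext big_nil.
  rewrite -[X in (_ + X)%E](big_pred1_eq +%E (val a).1 (fun=> block_weight w j (inl a))).
  rewrite [X in (_ + X)%E]big_mkcond -big_split /=; apply: eq_bigr => l _; rewrite /ext /= /segment_weight.
  have [->|la] := eqVneq l (val a).1.
    by rewrite -qS X0q1 end_up eqxx !big_cons big_nil adde0.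
  rewrite big_nil adde0; case: (boolP (X0 _)) => // h.
  by rewrite (negPf (end_other _ la (lab0 _ h))).
have phi_a : phi (0, (val a).1) = (0, lower_line a) by rewrite /phi eqxx.
have phi_id k : k != (0, (val a).1) -> phi k = k by rewrite /phi => /negPf->.
have phi0 l : phi (0, l) = (0, if l == (val a).1 then lower_line a else l).
  by rewrite /phi xpair_eqE eqxx /=; case: ifP.
have phiS b l : phi (b.+1, l) = (b.+1, l) by rewrite phi_id.
apply: (extend_family ff) => //.
- by rewrite leq_add2l.
- move=> [[|b] l] [[|b'] l'] h h'; rewrite ?phi0 ?phiS // => -[].
  have := lab0 _ h; have := lab0 _ h'.
  case: (eqVneq l (val a).1) => [->|_]; case: (eqVneq l' (val a).1) => [->|_] // h1 h2 e.
  + by rewrite -e eqxx in h1.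
  + by rewrite e eqxx in h2.
  + by rewrite e.
- case=> -[|b] l; rewrite /labels_of /=.
    have [e|ll] := eqVneq l (lower_line a).
      subst l; rewrite -/q Xq; split=> // _; exists (0, (val a).1) => //=.
      by rewrite -qS X0q1.
    have [e|lu] := eqVneq l (val a).1.
      subst l; rewrite -qS (negPf Xq1); split=> // -[[[|b] l] h]; rewrite ?phi0 ?phiS //.
      move=> [] /eqP; case: (eqVneq l (val a).1) => [_|lu]; last by rewrite (negPf lu).
      by rewrite (negPf low_up).
    rewrite -X0z ?lq ?lq1//; split=> [h|[[[|b] l'] h]].
    + by exists (0, l) => //; rewrite phi0 (negPf lu).
    + rewrite phi0 => -[] /eqP; case: (eqVneq l' (val a).1) => [_|_ /eqP <-//].
      by rewrite eq_sym (negPf ll).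
    + by rewrite phiS.
  have Xb : (X0 b.+1 = X b.+1) \/ ~~ (b < j).
    have [bj|] := ltnP b j; last by right.
    by left; apply: X0z; rewrite /q; clear -bj jK; lia.
  split=> [h|[[[|b'] l'] h]].
  + exists (b.+1, l) => /=; last by rewrite phiS.
    by case: Xb => [->//|/negPf nb]; move: h; rewrite nb.
  + by rewrite phi0.
  + rewrite phiS => -[e1 e2]; move: h; rewrite e1 e2 /=.
    by case: Xb => [->//|/negPf nb]; rewrite nb.
- move=> l h; rewrite /ext /=; case: (eqVneq l _) => [->|_]; last by [].
  split.
  + apply/and3P; split; [exact: eqxx | | by []].
    by rewrite chead_at// head_up ctail_at.
  + by rewrite /= !inordK// ltnSn.
  + move=> e; rewrite !inE => /orP[]/eqP->; rewrite chead_at// ?head_up.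
      by rewrite rank_vertex_at// ltn_add2l !leqnn.
    by rewrite [standard_head _]/= rank_vertex_at// ltn_add2l !leqnn.
  + rewrite map_cons map_cons cons_uniq inE andbT !chead_at// head_up.
    by apply/eqP => /vertex_at_inj.
- move=> l l' _ _ ll' e e'; rewrite /ext /=; case: eqP => // h1; case: eqP => // h2.
  by move: ll'; rewrite h1 h2 eqxx.
move=> l h; rewrite phi0 /ext /=; case: eqVneq => [_|lu] /=.
  by rewrite chead_at// /vertex_now ctail_at// -[m]/(point_time (inr a)) (tail_segment (inr a)).
by rewrite /vertex_now (segment_stay mn (end_other _ lu (lab0 _ h))).
Qed.

Lemma thaw_line off a lo hi X l : a < off -> lo <= hi ->
  thaw a (off + lo) (off + hi) X (off + l) = (lo <= l < hi + X a) || X (off + l).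
Proof.
move=> aoff lohi; rewrite /thaw gtn_eqF; last by rewrite ltn_addr.
rewrite eqn_add2l leq_add2l ltn_add2l; case: eqVneq => [->|lhi].
  by rewrite lohi /= -[X in X < _]addn0 ltn_add2l orbC; case: (X a).
congr (_ && _ || _); case: (X a); rewrite ?addn0// addn1 ltnS.
by rewrite ltn_neqAle lhi.
Qed.

(** Stopping appends no edge; it only changes the labels of the paths that stop. *)
Lemma reachable_freeze (R : realType) n K (w : forall j : 'I_K.+1, weighting R (stack n j))
    lo hi j cur clock (X : state) c :
  j <= K -> lo j <= hi j ->
  ~~ (X j.+1 && X (K.+2 + hi j)) ->
  (forall z, K.+2 + lo j <= z -> z < K.+2 + hi j -> X z = false) ->
  (forall l, cur l = boundary (stack n (K := K)) (inord j.+1) l) ->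
  reachable w lo hi j j.+1 cur clock (thaw j.+1 (K.+2 + lo j) (K.+2 + hi j) X) c ->
  reachable w lo hi j.+1 j.+1 cur clock X c.
Proof.
move=> jK lohi h1 h2 hcur [fam ff fw]; set X0 := thaw _ _ _ _ in ff.
have X0l l : X0 (K.+2 + l) = (lo j <= l < hi j + X j.+1) || X (K.+2 + l).
  by rewrite /X0 thaw_line.
have excl l : lo j <= l < hi j + X j.+1 -> X (K.+2 + l) = false.
  case/andP=> l1 l2; case: (ltnP l (hi j)) => [l3|l3].
    by apply: h2; rewrite ?leq_add2l ?ltn_add2l.
  move: h1 l2; case: (X j.+1) => /=; last by rewrite addn0 ltnNge l3.
  rewrite addn1 ltnS => /negPf nx l2; have -> : l = hi j by apply/eqP; rewrite eqn_leq l2 l3.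
  by [].
have X0b b : b < j -> X0 b.+1 = X b.+1.
  move=> bj; rewrite /X0 /thaw.
  have e1 : (b.+1 == j.+1) = false by rewrite eqSS ltn_eqF.
  have e2 : b.+1 < K.+2 by rewrite ltnS; exact: leq_trans bj (leqW jK).
  have e3 : (b.+1 == K.+2 + hi j) = false by rewrite ltn_eqF// ltn_addr.
  have e4 : (K.+2 + lo j <= b.+1) = false by apply/negbTE; rewrite -ltnNge ltn_addr.
  by rewrite e1 e3 e4.
pose ext (k : nat * 'I_n) : seq (cedge (stack n (K := K))) := [::].
pose phi (k : nat * 'I_n) := if (k.1 == 0) && (lo j <= k.2 < hi j + X j.+1) then (j.+1, k.2) else k.
have phi0 l : phi (0, l) = (if lo j <= l < hi j + X j.+1 then j.+1 else 0, l).
  by rewrite /phi /=; case: ifP.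
have phiS b l : phi (b.+1, l) = (b.+1, l) by [].
have phi2 k : (phi k).2 = k.2 by rewrite /phi; case: ifP.
exists (map (extend_path ext phi) fam); last first.
  rewrite extend_family_weight fw [X in (_ + X)%E]big1 ?adde0// => k _.
  by rewrite big_nil.
apply: (extend_family ff) => //.
- move=> [b l] [b' l'] h h' e; have el : l = l' by have := congr1 snd e; rewrite !phi2.
  subst l'; move: e h h'; case: b => [|b]; case: b' => [|b']; rewrite ?phi0 ?phiS //.
    by case: ifP => // _ [<-] _; rewrite /labels_of /= ltnn.
  by case: ifP => // _ [->]; rewrite /labels_of /= ltnn.
- case=> -[|b] l; rewrite /labels_of /=.
    split=> [h|[[[|b'] l'] h]]; last by rewrite phiS.
      exists (0, l); rewrite /= ?X0l ?h ?orbT// phi0.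
      by case: ifP => // /excl; rewrite h.
    by move: h; rewrite phi0 /= X0l; case: ifP => // _ /= h [<-].
  split=> [/andP[bj h]|[[[|b'] l'] h]].
  + move: bj; rewrite ltnS leq_eqVlt => /orP[/eqP e|bj].
      subst b; exists (0, l); first by rewrite /= X0l h.
      by rewrite phi0 h.
    by exists (b.+1, l) => //=; rewrite bj X0b.
  + move: h; rewrite phi0 /= X0l; case: ifP => // h _ [<- <-].
    by rewrite leqnn.
  + rewrite phiS => -[<- <-]; move: h => /= /andP[bj]; rewrite X0b// => ->.
    by rewrite (leq_trans bj).
move=> l h; rewrite phi0 /ext /=; case: ifP => // _.
split=> //; exists l; rewrite hcur; congr boundary.
by apply: val_inj; rewrite /= /bump /= !inordK.
Qed.

Lemma reachable_start (R : realType) n K (w : forall j : 'I_K.+1, weighting R (stack n j))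
    lo hi (X : state) :
  reachable w lo hi 0 0 (boundary (stack n (K := K)) (inord 0)) 0 X 0%E.
Proof.
pose fam : seq (labelled n K) := [seq ((0, l), (l, [::])) | l : 'I_n <- enum 'I_n & X (K.+2 + l)].
have ue : uniq [seq l <- enum 'I_n | X (K.+2 + nat_of_ord l)].
  by apply: filter_uniq; apply: enum_uniq.
have in0 : inord 0 = ord0 :> 'I_K.+2 by apply: val_inj; rewrite /= inordK.
exists fam; last by rewrite /family_weight big_map big1_seq// => i _; rewrite big_nil.
split.
- by rewrite -map_comp map_inj_uniq// => l l' [].
- case=> b l; rewrite -map_comp /labels_of unfold_in /=; apply/mapP/idP => [[l' + [-> ->]]|].
    by rewrite mem_filter => /andP[].
  case: b => [|b]; last by [].
  by rewrite unfold_in /= => h; exists l => //; rewrite mem_filter h mem_enum.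
- rewrite -map_comp /vertices /= (_ : flatten _ = [seq boundary (stack n (K := K)) ord0 l | l : 'I_n <- enum 'I_n & X (K.+2 + l)]).
    by rewrite map_inj_uniq// => l l' [].
  exact: flatten_map1.
- by move=> _ v /mapP[l _ ->] /=; rewrite inE => /eqP->.
- by move=> _ /mapP[l _ ->].
- by move=> _ /mapP[l _ ->] _; split=> //; rewrite in0.
- by move=> _ b /mapP[l _ ->].
Qed.

Lemma reachable_cur (R : realType) n K (w : forall j : 'I_K.+1, weighting R (stack n j))
    lo hi j J cur cur' clock clock' (X : state) c :
  (forall l, cur l = cur' l) -> clock = clock' ->
  reachable w lo hi j J cur clock X c -> reachable w lo hi j J cur' clock' X c.
Proof.
move=> h <- [fam [h1 h2 h3 h4 h5 h6 h7] fw]; exists fam => //; split=> // x xf x0.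
by rewrite -h; apply: h6.
Qed.

Lemma reachable_edge_steps (R : realType) n K (w : forall j : 'I_K.+1, weighting R (stack n j))
    lo hi j m f J (X : state) :
  j <= K -> J <= j.+1 -> m <= n * n ->
  (forall Y, f Y != -oo%E ->
     reachable w lo hi j J (vertex_now K j 0) (j * (n * n).+1) Y (f Y)) ->
  edge_steps K.+2 (block_weight w j) f m X != -oo%E ->
  reachable w lo hi j (if m == 0 then J else j.+1) (vertex_now K j m) (j * (n * n).+1 + m) X
    (edge_steps K.+2 (block_weight w j) f m X).
Proof.
move=> jK Jj + hf; elim: m X => [|m IHm] X mn /=; first by rewrite addn0; apply: hf.
have {}IHm Y := IHm Y (ltnW mn).
set J' := if m == 0 then J else j.+1 in IHm.
have J'j : J' <= j.+1 by rewrite /J'; case: ifP.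
rewrite /edge_step; set g := add_weights _ _ _.
have gN Y : g Y != -oo%E -> edge_steps K.+2 (block_weight w j) f m Y != -oo%E.
  by rewrite /g /add_weights adde_eq_ninfty negb_or => /andP[].
have stay Y : g Y != -oo%E ->
    reachable w lo hi j j.+1 (vertex_now K j m.+1) (j * (n * n).+1 + m.+1) Y (g Y).
  move=> /gN gY; apply: reachable_cur (reachable_segments jK J'j (IHm _ gY)) => // l.
  exact: vertex_nextE.
case: pickP => [a /eqP am|_]; last exact: stay.
case/step_downP=> [[gX ->]|[X1 X2 gX ->]]; first exact: stay.
subst m; rewrite /g /add_weights.
by apply: (reachable_down jK J'j X1 X2) => //; apply: IHm; apply: gN.
Qed.

(** Each maximum in the recursion is attained by one of its two branches, so by induction a value
    other than -oo comes with a family having exactly this weight. *)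
Lemma reachable_blocks (R : realType) n K (w : forall j : 'I_K.+1, weighting R (stack n j))
    lo hi j I X :
  j <= K.+1 -> (forall i, lo i <= hi i) ->
  blocks K.+2 (block_weight w) lo hi (@initial R I) j X != -oo%E ->
  reachable w lo hi j j (boundary (stack n (K := K)) (inord j)) (j * (n * n).+1) X
    (blocks K.+2 (block_weight w) lo hi (@initial R I) j X).
Proof.
move=> + lohi; elim: j X => [|j IHj] X jK /=.
  by move=> /initialP[_ ->]; rewrite mul0n; apply: reachable_start.
move=> /freezeP[h1 h2 h3 ->].
apply: reachable_freeze => //.
apply: (reachable_cur (cur := vertex_next K j (n * n)) (clock := j * (n * n).+1 + (n * n).+1)).
- by move=> l; apply: vertex_next_end.
- by rewrite mulSn addnC.
rewrite -[block _ _ _ _]/(add_weights _ _ _ _) /block /add_weights in h3 *.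
set Y := thaw _ _ _ _ in h3 *.
move: h3; rewrite adde_eq_ninfty negb_or => /andP[h3 _].
have := @reachable_edge_steps _ _ _ w lo hi j (n * n) _ j Y jK (leqnSn j) (leqnn _) _ h3.
move=> /(_ _) r.
apply: (reachable_segments (J := if n * n == 0 then j else j.+1)) => //.
  by case: ifP.
apply: r => Z hZ; apply: reachable_cur (IHj _ (ltnW jK) hZ) => // l.
by rewrite vertex_now0.
Qed.

Lemma perm_flatten_filter (T I : eqType) (f : T -> I) (s : seq T) (r : seq I) : uniq r ->
  perm_eq (flatten [seq [seq x <- s | f x == i] | i <- r]) [seq x <- s | f x \in r].
Proof.
elim: r => [_|i r IHr /= /andP[ir ur]] /=; first by rewrite (eq_filter (a2 := pred0)) ?filter_pred0.
apply/permP => a; rewrite count_cat (permP (IHr ur)) !count_filter.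
rewrite -count_predUI [X in _ + X](@eq_count _ _ pred0) ?count_pred0 ?addn0.
  by apply: eq_count => x /=; rewrite inE andb_orr.
move=> x /=; apply/negbTE; apply: contra ir.
by case/andP => /andP[_ /eqP<-] /andP[].
Qed.

Lemma card_ord_interval n lo hi : lo <= hi -> hi <= n ->
  count (fun l : 'I_n => lo <= l < hi) (enum 'I_n) = hi - lo.
Proof.
move=> h1 h2; rewrite -(count_map (@nat_of_ord n) (fun l => lo <= l < hi)) val_enum_ord.
have -> : n = lo + ((hi - lo) + (n - hi)) by lia.
rewrite !iotaD !count_cat add0n.
rewrite (@eq_in_count _ _ pred0) => [|x]; last by rewrite mem_iota /=; lia.
rewrite [X in _ + (X + _)](@eq_in_count _ _ predT) => [|x]; last by rewrite mem_iota /=; lia.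
rewrite [X in _ + (_ + X)](@eq_in_count _ _ pred0) => [|x]; last by rewrite mem_iota /=; lia.
by rewrite !count_pred0 count_predT size_iota addn0.
Qed.

(** No line is occupied after the last boundary, so every path of the family has stopped. Sorting
    the paths by the boundary where they stopped gives a multipath, for any weighting. *)
Lemma blocks_le_max_weight (R : realType) n K (w : forall j : 'I_K.+1, weighting R (stack n j))
    (lo hi : nat -> nat) I (X : state) (alpha : 'I_K.+1 -> nat) :
  (forall i, lo i <= hi i) ->
  (forall b : 'I_K.+1, hi b + X b.+1 <= n /\ alpha b = hi b + X b.+1 - lo b) ->
  (forall l : 'I_n, X (K.+2 + l) = false) ->
  (blocks K.+2 (block_weight w) lo hi (@initial R I) K.+1 X <= max_weight w alpha)%E.
Proof.
move=> lohi halpha hX.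
have [->|hN] := eqVneq (blocks K.+2 (block_weight w) lo hi (@initial R I) K.+1 X) -oo%E.
  by rewrite leNye.
have [fam [fu fl fd _ _ _ fs] <-] := reachable_blocks (leqnn _) lohi hN.
pose p (i : 'I_K.+1) : seq (cpath (stack n (K := K))) := [seq x.2 | x <- fam & x.1.1 == i.+1].
have lab x : x \in fam -> x.1.1 \in [seq (nat_of_ord i).+1 | i <- enum 'I_K.+1].
  move=> xf; have := map_f fst xf; rewrite fl /labels_of unfold_in.
  case: x.1 => -[|b] l /=; first by rewrite hX.
  case/andP => bK _; apply/mapP; exists (Ordinal bK) => //.
  by rewrite mem_enum.
have up : uniq [seq (nat_of_ord i).+1 | i <- enum 'I_K.+1].
  by rewrite map_inj_uniq ?enum_uniq// => i i' [] /ord_inj.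
have := perm_flatten_filter (fun x : labelled n K => x.1.1) fam up.
rewrite -map_comp (_ : [seq x <- fam | _] = fam); last by apply/all_filterP/allP => x /lab.
set q := flatten _ => pq.
apply: ereal_sup_ubound; exists p; last first.
  rewrite /multipath_weight /family_weight -(perm_big _ pq) /q big_flatten big_map -big_enum /=.
  by apply: eq_bigr => i _; rewrite big_map.
split.
- move=> i; have [h1 ->] := halpha i; rewrite -(card_ord_interval _ h1); last first.
    by apply: leq_trans (lohi i) _; rewrite leq_addr.
  rewrite size_map size_filter -(count_map fst (fun k => k.1 == i.+1)) -!size_filter.
  rewrite -(size_map (fun l : 'I_n => (i.+1, l))); apply: perm_size; apply: uniq_perm.
  + exact: filter_uniq.
  + rewrite map_inj_uniq; first by apply: filter_uniq; apply: enum_uniq.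
    by move=> l l' [].
  move=> [b l]; rewrite mem_filter fl /labels_of [_ \in labels_of _ _ _ _ _]unfold_in.
  apply/andP/mapP => /= [[/eqP-> /andP[_ h]]|[l']].
    by exists l => //; rewrite mem_filter h mem_enum.
  by rewrite mem_filter => /andP[h _] [-> ->]; rewrite eqxx ltn_ord h.
- move=> i x /mapP[y]; rewrite mem_filter => /andP[/eqP yi yf] ->.
  by have [_] := fs _ _ yf yi; rewrite inord_val.
have /perm_uniq -> // : perm_eq (flatten [seq vertices x | i <- enum 'I_K.+1, x <- p i])
    (flatten [seq vertices x.2 | x <- fam]).
apply: perm_flatten.
rewrite -(permPr (perm_map (fun x : labelled n K => vertices x.2) pq)) /q map_flatten -map_comp.
rewrite (_ : [seq _ | i <- _, x <- _] = flatten (map ((map (fun x : labelled n K => vertices x.2)) \o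
  ((fun i => [seq x <- fam | x.1.1 == i]) \o (fun i : 'I_K.+1 => i.+1))) (enum 'I_K.+1))) //.
by congr flatten; apply: eq_map => i /=; rewrite /p -map_comp.
Qed.

(** * The flow of a multipath *)

(** The vertices of a family of paths can be listed as starts and heads, or as tails and finishes.
    Comparing the two lists gives the conservation law at each vertex, with no reference to the
    order of the edges. *)
Lemma perm_vertices_heads n k (N : 'I_k -> network n) (P : seq (cpath N)) :
  perm_eq (flatten (map (@vertices n k N) P))
          (map (@start n k N) P ++ map (@chead n k N) (flatten (map snd P))).
Proof.
elim: P => //= x P IHP; rewrite map_cat /vertices /= perm_cons.
by rewrite perm_sym perm_catCA perm_cat2l perm_sym.
Qed.

Lemma vertices_tails n k (N : 'I_k -> network n) (v : cvertex N) s : walk v s ->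
  v :: map (@chead n k N) s = rcons (map (@ctail n k N) s) (last v (map (@chead n k N) s)).
Proof. by elim: s v => //= e s IHs v /andP[/eqP-> /IHs->]. Qed.

Lemma perm_vertices_tails n k (N : 'I_k -> network n) (P : seq (cpath N)) :
  (forall x, x \in P -> walk (start x) x.2) ->
  perm_eq (flatten (map (@vertices n k N) P))
          (map (@ctail n k N) (flatten (map snd P)) ++ map (@finish n k N) P).
Proof.
elim: P => [//|x P IHP hw]; have ex : vertices x = map (@ctail n k N) x.2 ++ [:: finish x].
  by rewrite cats1; apply: vertices_tails; apply: hw; rewrite mem_head.
rewrite !map_cons -[flatten (vertices x :: _)]/(vertices x ++ flatten _).
rewrite -[flatten (x.2 :: _)]/(x.2 ++ flatten _) map_cat ex -!catA perm_cat2l.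
rewrite perm_sym -[finish x :: _]/([:: finish x] ++ _) perm_catCA perm_cat2l perm_sym.
by apply: IHP => y yP; apply: hw; rewrite inE yP orbT.
Qed.

Lemma uniq_map_inj (T U : eqType) (f : T -> U) (s : seq T) : uniq (map f s) ->
  {in s &, injective f}.
Proof.
elim: s => //= x s IHs /andP[xs us] a b; rewrite !inE.
case/orP=> [/eqP->|ha] /orP[/eqP->|hb] //; last exact: IHs.
  by move=> e; case/negP: xs; rewrite e map_f.
by move=> e; case/negP: xs; rewrite -e map_f.
Qed.

Definition multipath_paths n k (N : 'I_k -> network n) (p : 'I_k -> seq (cpath N)) :
  seq (cpath N) := flatten [seq p i | i <- enum 'I_k].

Definition multipath_edges n k (N : 'I_k -> network n) (p : 'I_k -> seq (cpath N)) :
  seq (cedge N) := flatten (map snd (multipath_paths p)).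

Lemma multipath_weightE (R : realType) n k (N : 'I_k -> network n)
    (w : forall j, weighting R (N j)) p :
  (multipath_weight w p = \sum_(e <- multipath_edges p) cweight w e)%E.
Proof.
by rewrite /multipath_weight /multipath_edges !big_flatten !big_map big_flatten big_map big_enum.
Qed.

Lemma mem_multipath_paths n k (N : 'I_k -> network n) (p : 'I_k -> seq (cpath N)) x :
  reflect (exists i, x \in p i) (x \in multipath_paths p).
Proof.
apply: (iffP flatten_mapP) => [[i _ h]|[i h]]; first by exists i.
by exists i; rewrite ?mem_enum.
Qed.

(* The edges of a family of disjoint paths, from the sources in src to the sinks of the
   j-th network in snk j: at each attaching point at most one path comes in, and
   it goes out. *)
Record flow n K (E : seq (cedge (stack n (K := K)))) (src : pred 'I_n)
    (snk : nat -> pred 'I_n) : Prop := Flow {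
  flow_uniq : uniq E;
  flow_source : forall l, (at_block K 0 (segment 0 l) \in E) = src l;
  flow_start : forall j (a : slanted n), j <= K ->
    let m := slant_time a in
    (at_block K j (segment m (val a).1) \in E) =
      (at_block K j (segment m.+1 (val a).1) \in E) (+) (at_block K j (inl a) \in E) /\
    ~~ ((at_block K j (segment m.+1 (val a).1) \in E) && (at_block K j (inl a) \in E));
  flow_end : forall j (a : slanted n), j <= K ->
    let m := slant_time a in
    (at_block K j (segment m.+1 (lower_line a)) \in E) =
      (at_block K j (segment m (lower_line a)) \in E) (+) (at_block K j (inl a) \in E) /\
    ~~ ((at_block K j (segment m (lower_line a)) \in E) && (at_block K j (inl a) \in E));
  flow_boundary : forall j l, j < K ->
    (at_block K j (segment (n * n) l) \in E) =
      (at_block K j.+1 (segment 0 l) \in E) (+) snk j l /\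
    ~~ ((at_block K j.+1 (segment 0 l) \in E) && snk j l);
  flow_sink : forall l, (at_block K K (segment (n * n) l) \in E) = snk K l
}.

Lemma cedge_at n K (c : cedge (stack n (K := K))) : c = at_block K (tag c) (tagged c).
Proof. by case: c => i e; rewrite /at_block /= inord_val. Qed.

Lemma tag_le n K (c : cedge (stack n (K := K))) : tag c <= K.
Proof. by rewrite -ltnS ltn_ord. Qed.

Lemma vertex_at_block_inj n K i j p q : i <= K -> j <= K ->
  @vertex_at n K i p = vertex_at K j q -> i = j /\ p = q.
Proof.
move=> iK jK h; have ij : i = j.
  move: h; rewrite /vertex_at /inside => -[] h _.
  by have := congr1 (@nat_of_ord _) h; rewrite !inordK.
by subst j; split=> //; exact: (vertex_at_inj h).
Qed.

Lemma chead_vertex_at n K (c : cedge (stack n (K := K))) j p : j <= K ->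
  chead c = vertex_at K j p -> exists2 e, c = at_block K j e & standard_head e = inl p.
Proof.
move=> jK; rewrite {1}(cedge_at c) chead_at ?tag_le//.
case E : standard_head => [q|i] // /vertex_at_block_inj[||<- <-//]; rewrite ?tag_le//.
by exists (tagged c); rewrite -?cedge_at.
Qed.

Lemma ctail_vertex_at n K (c : cedge (stack n (K := K))) j p : j <= K ->
  ctail c = vertex_at K j p -> exists2 e, c = at_block K j e & standard_tail e = inr p.
Proof.
move=> jK; rewrite {1}(cedge_at c) ctail_at ?tag_le//.
case E : standard_tail => [i|q] // /vertex_at_block_inj[||<- <-//]; rewrite ?tag_le//.
by exists (tagged c); rewrite -?cedge_at.
Qed.

Lemma boundary_inj n K i j l l' : i <= K.+1 -> j <= K.+1 ->
  boundary (stack n (K := K)) (inord i) l = boundary (stack n (K := K)) (inord j) l' ->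
  i = j /\ l = l'.
Proof.
move=> iK jK [h ->]; split=> //.
by have := congr1 (@nat_of_ord _) h; rewrite !inordK.
Qed.

Lemma chead_boundary n K (c : cedge (stack n (K := K))) j l : j <= K ->
  chead c = boundary (stack n (K := K)) (inord j.+1) l -> c = at_block K j (segment (n * n) l).
Proof.
move=> jK; rewrite {1}(cedge_at c) chead_at ?tag_le//.
case E : standard_head => [q|i] // e.
have [[h] hl] := boundary_inj (tag_le c : (tag c).+1 <= K.+1) (jK : j.+1 <= K.+1) e.
by rewrite (cedge_at c) (head_sink E) hl h.
Qed.

Lemma ctail_boundary n K (c : cedge (stack n (K := K))) j l : j <= K ->
  ctail c = boundary (stack n (K := K)) (inord j) l -> c = at_block K j (segment 0 l).
Proof.
move=> jK; rewrite {1}(cedge_at c) ctail_at ?tag_le//.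
case E : standard_tail => [i|q] // e.
have [h hl] := boundary_inj (leqW (tag_le c)) (leqW jK) e.
by rewrite (cedge_at c) (tail_source E) hl h.
Qed.

Lemma chead_boundary_first n K (c : cedge (stack n (K := K))) l :
  chead c <> boundary (stack n (K := K)) (inord 0) l.
Proof.
rewrite (cedge_at c) chead_at ?tag_le//.
by case: standard_head => [q|i] // /(boundary_inj (tag_le c : (tag c).+1 <= K.+1) (leq0n _))[].
Qed.

Lemma ctail_boundary_last n K (c : cedge (stack n (K := K))) l :
  ctail c <> boundary (stack n (K := K)) (inord K.+1) l.
Proof.
rewrite (cedge_at c) ctail_at ?tag_le//.
case: standard_tail => [i|q] // /(boundary_inj (leqW (tag_le c)) (leqnn _))[h _].
by have := tag_le c; rewrite h ltnn.
Qed.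

(** By disjointness, a vertex is the head of at most one edge and the tail of at most one. At an
    attaching point, which is neither a start nor a finish, being a head is then the same as being a
    tail; boundary points are treated likewise, with the stopped paths as finishes. *)
Lemma multipath_flow n K (alpha : 'I_K.+1 -> nat) (p : 'I_K.+1 -> seq (cpath (stack n (K := K))))
    (src : pred 'I_n) (snk : nat -> pred 'I_n) :
  is_multipath alpha p ->
  (forall s, (exists i, exists2 x, x \in p i & start x = boundary (stack n (K := K)) ord0 s) <-> src s) ->
  (forall (i : 'I_K.+1) t,
     (exists2 x, x \in p i & finish x = boundary (stack n (K := K)) (lift ord0 i) t) <-> snk i t) ->
  flow (multipath_edges p) src snk.
Proof.
move=> [_ hp hu] hsrc hsnk; set P := multipath_paths p.
have walkP x : x \in P -> walk (start x) x.2.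
  by move=> /mem_multipath_paths[i /hp[]].
have uV : uniq (flatten (map (@vertices n K.+1 (stack n (K := K))) P)).
  move: hu; congr (is_true (uniq (flatten _))).
  by rewrite /P /multipath_paths map_flatten -map_comp.
set E := multipath_edges p.
pose heads := map (@chead n K.+1 (stack n (K := K))) E.
pose tails := map (@ctail n K.+1 (stack n (K := K))) E.
pose starts := map (@start n K.+1 (stack n (K := K))) P.
pose finishes := map (@finish n K.+1 (stack n (K := K))) P.
have pH : perm_eq (flatten (map (@vertices n K.+1 (stack n (K := K))) P)) (starts ++ heads).
  exact: perm_vertices_heads.
have pT : perm_eq (flatten (map (@vertices n K.+1 (stack n (K := K))) P)) (tails ++ finishes).
  exact: perm_vertices_tails.
have HT v : (v \in starts) || (v \in heads) = (v \in tails) || (v \in finishes).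
  by rewrite -!mem_cat -(perm_mem pH) -(perm_mem pT).
have := uV; rewrite (perm_uniq pH) cat_uniq => /and3P[_ dH uH].
have := uV; rewrite (perm_uniq pT) cat_uniq => /and3P[uT dT _].
have uE : uniq E := map_uniq uH.
have injH := uniq_map_inj uH; have injT := uniq_map_inj uT.
have inner_start j q : vertex_at K j q \notin starts by apply/mapP => -[x _].
have inner_finish j q : vertex_at K j q \notin finishes.
  by apply/mapP => -[x /mem_multipath_paths[i /hp[_ _ [t ->]]]].
have balance j q : (vertex_at K j q \in heads) = (vertex_at K j q \in tails).
  by have := HT (vertex_at K j q); rewrite (negPf (inner_start _ _)) (negPf (inner_finish _ _)) orbF.
have inh c : c \in E -> chead c \in heads by apply: map_f.
have int c : c \in E -> ctail c \in tails by apply: map_f.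
have bH j l : j <= K -> (boundary (stack n (K := K)) (inord j.+1) l \in heads) =
    (at_block K j (segment (n * n) l) \in E).
  move=> jK; apply/mapP/idP => [[c cE /esym /(chead_boundary jK) <- //]|h].
  by exists (at_block K j (segment (n * n) l)); rewrite // chead_at// head_segment_end.
have bT j l : j <= K -> (boundary (stack n (K := K)) (inord j) l \in tails) =
    (at_block K j (segment 0 l) \in E).
  move=> jK; apply/mapP/idP => [[c cE /esym /(ctail_boundary jK) <- //]|h].
  by exists (at_block K j (segment 0 l)); rewrite // ctail_at// tail_segment0.
have lift_inord j : j <= K -> lift ord0 (inord j : 'I_K.+1) = inord j.+1 :> 'I_K.+2.
  by move=> jK; apply: val_inj; rewrite /= /bump /= !inordK.
have bF j l : j <= K -> (boundary (stack n (K := K)) (inord j.+1) l \in finishes) = snk j l.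
  move=> jK; apply/mapP/idP => [[x /mem_multipath_paths[i xi] ex]|].
    have [_ _ [t xt]] := hp _ _ xi.
    have ij : i = j :> nat.
      move: ex; rewrite xt => -[h _]; have := congr1 (@nat_of_ord _) h.
      by rewrite inordK//= /bump /= => -[].
    by rewrite -ij; apply/hsnk; exists x => //; rewrite -ex -ij -lift_inord ?inord_val// -ltnS.
  rewrite -{1}(inordK (jK : j < K.+1)) => /hsnk[x xj xe]; exists x.
    by apply/mem_multipath_paths; exists (inord j).
  by rewrite xe lift_inord.
have bS j l : j <= K -> boundary (stack n (K := K)) (inord j.+1) l \notin starts.
  move=> jK; apply/mapP => -[x _ [h _]]; have := congr1 (@nat_of_ord _) h.
  by rewrite inordK.
have in0 : inord 0 = ord0 :> 'I_K.+2 by apply: val_inj; rewrite /= inordK.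
have xor (x y d : bool) : x = y || d -> ~~ (y && d) -> x = y (+) d /\ ~~ (y && d).
  by move=> -> h; split=> //; move: h; case: y; case: d.
split=> //.
- move=> l; rewrite -bT//; have := HT (boundary (stack n (K := K)) (inord 0) l).
  have -> : (boundary (stack n (K := K)) (inord 0) l \in heads) = false.
    by apply/mapP => -[c _ /esym]; apply: chead_boundary_first.
  have -> : (boundary (stack n (K := K)) (inord 0) l \in finishes) = false.
    apply/mapP => -[x /mem_multipath_paths[i /hp[_ _ [t ->]]]] [h _].
    by have := congr1 (@nat_of_ord _) h; rewrite in0.
  rewrite !orbF => <-; rewrite in0; apply/mapP/idP => [[x /mem_multipath_paths[i xi] ex]|].
    by apply/hsrc; exists i, x.
  move=> /hsrc[i [x xi xe]]; exists x; rewrite ?xe//.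
  by apply/mem_multipath_paths; exists i.
- move=> j a jK m; have hu' := head_segment (inl a); have tu := tail_segment (inl a).
  apply: xor; last first.
    apply/negP => /andP[h1 h2]; have := injT _ _ h1 h2; rewrite !ctail_at// tu.
    by move=> /(_ erefl) /at_block_inj.
  have tE : (vertex_at K j (inl a) \in tails) =
      (at_block K j (segment m.+1 (val a).1) \in E) || (at_block K j (inl a) \in E).
    apply/mapP/orP => [[c cE /esym /(ctail_vertex_at jK)[e ce /tail_point[ee|[b ee [ab]]]]]|[h|h]].
    + by left; rewrite -[m]/(point_time (inl a)) -[(val a).1]/(point_line (inl a)) -ee -ce.
    + by right; rewrite ab -ee -ce.
    + by exists (at_block K j (segment m.+1 (val a).1)); rewrite // ctail_at// tu.
    + by exists (at_block K j (inl a)); rewrite // ctail_at.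
  rewrite -tE -balance; apply/idP/mapP => [h|[c cE /esym /(chead_vertex_at jK)[e ce /head_point[ee|[b ee]//]]]].
    by exists (at_block K j (segment m (val a).1)); rewrite // chead_at// hu'.
  by rewrite -[m]/(point_time (inl a)) -[(val a).1]/(point_line (inl a)) -ee -ce.
- move=> j a jK m; have hu' := head_segment (inr a); have tu := tail_segment (inr a).
  apply: xor; last first.
    apply/negP => /andP[h1 h2]; have := injH _ _ h1 h2; rewrite !chead_at// hu'.
    by move=> /(_ erefl) /at_block_inj.
  have hE : (vertex_at K j (inr a) \in heads) =
      (at_block K j (segment m (lower_line a)) \in E) || (at_block K j (inl a) \in E).
    apply/mapP/orP => [[c cE /esym /(chead_vertex_at jK)[e ce /head_point[ee|[b ee [ab]]]]]|[h|h]].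
    + by left; rewrite -[m]/(point_time (inr a)) -[lower_line a]/(point_line (inr a)) -ee -ce.
    + by right; rewrite ab -ee -ce.
    + by exists (at_block K j (segment m (lower_line a))); rewrite // chead_at// hu'.
    + by exists (at_block K j (inl a)); rewrite // chead_at.
  rewrite -hE balance; apply/idP/mapP => [h|[c cE /esym /(ctail_vertex_at jK)[e ce /tail_point[ee|[b ee]//]]]].
    by exists (at_block K j (segment m.+1 (lower_line a))); rewrite // ctail_at// tu.
  by rewrite -[m]/(point_time (inr a)) -[lower_line a]/(point_line (inr a)) -ee -ce.
- move=> j l jK; have jK' := ltnW jK; apply: xor.
    rewrite -bH// -bT// -bF//; have := HT (boundary (stack n (K := K)) (inord j.+1) l).
    by rewrite (negPf (bS _ _ jK')).
  rewrite -bT// -bF//; apply/negP => /andP[h1 h2]; case/hasP: dT.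
  by exists (boundary (stack n (K := K)) (inord j.+1) l).
move=> l; rewrite -bH// -bF//; have := HT (boundary (stack n (K := K)) (inord K.+1) l).
rewrite (negPf (bS _ _ (leqnn K))) /= => ->; rewrite orb_idl// => /mapP[c _ /esym].
by move/ctail_boundary_last.
Qed.

(** Without the guard [j <= K], [inord] would send [K.+1] to a default network; with it, all lines
    are empty after the last boundary. *)
Definition line_used n K (E : seq (cedge (stack n (K := K)))) (j m l : nat) : bool :=
  (j <= K) && (if insub l is Some l' then at_block K j (segment m (l' : 'I_n)) \in E else false).

(** By [z <= j] a flag is raised only once its boundary has been passed; the flag 0, which concerns
    the sources, counts from the outset. *)
Definition flow_state n K (E : seq (cedge (stack n (K := K)))) (fl : state) (j m : nat) : state :=
  fun z => if z < K.+2 then (z <= j) && fl z else line_used E j m (z - K.+2).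

Lemma flow_state_line n K (E : seq (cedge (stack n (K := K)))) fl j m (l : 'I_n) : j <= K ->
  flow_state E fl j m (K.+2 + l) = (at_block K j (segment m l) \in E).
Proof. by move=> jK; rewrite /flow_state ltnNge leq_addr /= addKn /line_used jK valK. Qed.

Lemma flow_state_out n K (E : seq (cedge (stack n (K := K)))) fl j m l : n <= l ->
  flow_state E fl j m (K.+2 + l) = false.
Proof.
move=> nl; rewrite /flow_state ltnNge leq_addr /= addKn /line_used insubF ?andbF//.
by apply/negbTE; rewrite -leqNgt.
Qed.

Lemma state_split off (X Y : state) : (forall z, z < off -> X z = Y z) ->
  (forall l, X (off + l) = Y (off + l)) -> X = Y.
Proof.
move=> h1 h2; apply: funext => z; have [zo|zo] := ltnP z off; first exact: h1.
by rewrite -(subnKC zo).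
Qed.

Definition edge_key n K (c : cedge (stack n (K := K))) : nat :=
  tag c * (n * n).+1 + end_time (tagged c).

Definition weight_before (R : realType) n K (w : forall j : 'I_K.+1, weighting R (stack n j))
    (E : seq (cedge (stack n (K := K)))) (C : nat) : \bar R :=
  (\sum_(c <- E | (edge_key c < C)%N) cweight w c)%E.

Lemma edge_key_eq n K (c : cedge (stack n (K := K))) j m : m <= n * n ->
  edge_key c == j * (n * n).+1 + m -> tag c = j :> nat /\ end_time (tagged c) = m.
Proof.
move=> mn /eqP h; have h1 := end_time_le (tagged c); have h2 := congr1 (fun x => x %/ (n * n).+1) h.
have h3 := congr1 (fun x => x %% (n * n).+1) h.
move: h2 h3; rewrite /edge_key /= !divnMDl// !modnMDl !divn_small ?ltnS// !addn0 !modn_small//.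
Qed.

Lemma weight_before_step (R : realType) n K (w : forall j : 'I_K.+1, weighting R (stack n j))
    (E : seq (cedge (stack n (K := K)))) fl j m :
  uniq E -> j <= K -> m <= n * n ->
  weight_before w E (j * (n * n).+1 + m).+1 =
  (weight_before w E (j * (n * n).+1 + m) +
   (\sum_(l < n) (if flow_state E fl j m (K.+2 + l)%N
                  then segment_weight (block_weight w j) m l else 0) +
    \sum_(a : slanted n | slant_time a == m)
       (if at_block K j (inl a) \in E then block_weight w j (inl a) else 0)))%E.
Proof.
move=> uE jK mn; set C := j * _ + m.
have -> : (weight_before w E C.+1 = weight_before w E C + \sum_(c <- E | edge_key c == C) cweight w c)%E.
  rewrite /weight_before big_mkcond [X in _ = (X + _)%E]big_mkcond [X in _ = (_ + X)%E]big_mkcond -big_split /=.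
  by apply: eq_bigr => c _; rewrite ltnS; case: ltngtP; rewrite ?adde0 ?add0e.
congr (_ + _)%E.
pose L1 := [seq at_block K j (segment m l) | l <- index_enum 'I_n & end_time (segment m l) == m].
pose L2 := [seq at_block K j (inl a) | a <- index_enum (slanted n) & slant_time a == m].
have pL : perm_eq [seq c <- E | edge_key c == C] [seq c <- L1 ++ L2 | c \in E].
  apply: uniq_perm; first exact: filter_uniq.
    apply: filter_uniq; rewrite cat_uniq; apply/and3P; split.
    - rewrite map_inj_uniq ?filter_uniq ?index_enum_uniq// => l l' /at_block_inj.
      exact: segment_line.
    - apply/hasPn => c /mapP[a _ ->]; apply/mapP => -[l _ /at_block_inj].
      by [].
    - rewrite map_inj_uniq ?filter_uniq ?index_enum_uniq// => a a' /at_block_inj.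
      by case.
  move=> c; rewrite !mem_filter; case cE : (c \in E); last by rewrite andbF.
  rewrite andbT /= mem_cat; apply/idP/orP => [|[|] /mapP[x + ->]]; last 2 first.
  - by rewrite mem_filter => /andP[/eqP xm _]; rewrite /edge_key /= inordK// xm.
  - rewrite mem_filter => /andP[/eqP xm _]; rewrite /edge_key /= inordK//.
    by rewrite -[end_time _]/(slant_time x) xm.
  move/(edge_key_eq mn) => [tc ec]; rewrite (cedge_at c) tc.
  case: (tagged c) ec => [a ea|[l r] er].
    right; apply/mapP; exists a => //; rewrite mem_filter mem_index_enum andbT.
    by rewrite -ea.
  left; apply/mapP; exists l; last by rewrite end_time_segment er.
  by rewrite mem_filter mem_index_enum andbT -er -end_time_segment.
rewrite -big_filter (perm_big _ pL) big_filter big_cat /= !big_map !big_filter_cond.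
congr (_ + _)%E.
  rewrite big_mkcond; apply: eq_bigr => l _; rewrite flow_state_line// /segment_weight.
  by case: eqP; case: (_ \in E).
by rewrite big_mkcondr.
Qed.

(** A maximum dominates its branches, so it suffices to follow the branch dictated by [E]: move down
    at time [m] exactly if the slanted edge of that time is in [E]. The flow equations at the ends
    of this edge are the update of the state. *)
Lemma flow_edge_steps (R : realType) n K (w : forall j : 'I_K.+1, weighting R (stack n j))
    (E : seq (cedge (stack n (K := K)))) src snk fl f j m :
  flow E src snk -> j <= K -> m <= n * n ->
  (weight_before w E (j * (n * n).+1) <= f (flow_state E fl j 0))%E ->
  (weight_before w E (j * (n * n).+1 + m) <=
   edge_steps K.+2 (block_weight w j) f m (flow_state E fl j m))%E.
Proof.
move=> hE jK + hf; elim: m => [|m IHm] mn; first by rewrite addn0.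
have {}IHm := IHm (ltnW mn).
rewrite addnS (weight_before_step _ fl (flow_uniq hE) jK (ltnW mn)) addeA /= /edge_step.
set g := add_weights _ _ _.
have hg : (weight_before w E (j * (n * n).+1 + m) +
    \sum_(l < n) (if flow_state E fl j m (K.+2 + l)%N
                  then segment_weight (block_weight w j) m l else 0) <=
    g (flow_state E fl j m))%E by apply: leeD.
have eqS (ls : seq 'I_n) : (forall l, l \notin ls -> end_time (segment m l) != m) ->
    forall l, l \notin ls ->
    flow_state E fl j m.+1 (K.+2 + l) = flow_state E fl j m (K.+2 + l).
  by move=> h l ll; rewrite !flow_state_line// segment_stay// h.
have out (a : slanted n) (l : 'I_n) : slant_time a = m -> l != (val a).1 -> l != lower_line a ->
    end_time (segment m l) != m.
  move=> am l1 l2; apply/eqP => hl.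
  have [p [pl pt _]] := end_time_point_exists mn hl.
  have ea : point_edge p = a by apply: slant_time_inj; rewrite am.
  by case: p pl pt ea l1 l2 => b /= <- _ ->; rewrite eqxx.
case: pickP => [a /eqP am|ha]; last first.
  rewrite [X in (_ + X)%E]big_pred0 ?adde0//.
  suff -> : flow_state E fl j m.+1 = flow_state E fl j m by [].
  apply: (@state_split K.+2) => [z zK|l]; first by rewrite /flow_state zK.
  have [ln|nl] := ltnP l n; last by rewrite !flow_state_out.
  apply: (eqS [::] _ (Ordinal ln)) => // l' _; apply/eqP => /(end_time_point_exists mn)[p [_ pt _]].
  by have := ha (point_edge p); rewrite -pt eqxx.
rewrite (big_pred1 a); last first.
  by move=> b /=; apply/eqP/eqP => [bm|->//]; apply: slant_time_inj; rewrite bm.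
have [s1 s2] := flow_start hE a jK; have [e1 e2] := flow_end hE a jK.
rewrite am in s1 s2 e1 e2; set d := at_block K j (inl a) \in E in s1 s2 e1 e2 *.
set q := K.+2 + lower_line a; have qS : q.+1 = K.+2 + (val a).1 by rewrite /q -lower_lineS addnS.
have other : forall l, l != (val a).1 -> l != lower_line a ->
    flow_state E fl j m.+1 (K.+2 + l) = flow_state E fl j m (K.+2 + l).
  move=> l l1 l2; apply: (eqS [:: (val a).1; lower_line a]); rewrite ?inE ?negb_or ?l1 ?l2//.
  by move=> l'; rewrite !inE negb_or => /andP[]; apply: out.
have eqz (X Y : state) : X q = Y q -> X q.+1 = Y q.+1 ->
    (forall z, z != q -> z != q.+1 -> X z = flow_state E fl j m.+1 z) ->
    (forall z, z != q -> z != q.+1 -> Y z = flow_state E fl j m z) -> X = Y.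
  move=> h1 h2 h3 h4; apply: (state_eq2 h1 h2) => z zq zq1; rewrite h3// h4//.
  have [zK|zK] := ltnP z K.+2; first by rewrite /flow_state zK.
  move: zq zq1; rewrite -(subnKC zK) qS /q !eqn_add2l => zq zq1.
  have [ln|nl] := ltnP (z - K.+2) n; last by rewrite !flow_state_out.
  exact: (other (Ordinal ln)).
have stq : flow_state E fl j m.+1 q = flow_state E fl j m q (+) d.
  by rewrite !flow_state_line.
have stq1 : flow_state E fl j m q.+1 = flow_state E fl j m.+1 q.+1 (+) d.
  by rewrite qS !flow_state_line.
case dE : d in s1 s2 e1 e2 stq stq1 *; last first.
  rewrite adde0; apply: le_trans (step_down_stay _ _ _ _).
  suff -> : flow_state E fl j m.+1 = flow_state E fl j m by [].
  by apply: eqz; rewrite ?stq ?stq1 ?addbF.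
have q0 : flow_state E fl j m q = false.
  by rewrite flow_state_line//; move: e2; rewrite andbT => /negPf.
have q1 : flow_state E fl j m.+1 q.+1 = false.
  by rewrite qS flow_state_line//; move: s2; rewrite andbT => /negPf.
apply: le_trans (step_down_move _ _ _ _); last by rewrite q1.
  apply: leeD => //; suff -> : flow_state E fl j m.+1 \o transp q q.+1 = flow_state E fl j m by [].
  apply: eqz => [|||//].
  - by rewrite /= transpl q0 q1.
  - by rewrite /= transpr stq stq1 q0 q1.
  - by move=> z z1 z2; rewrite /= transp_id.
by rewrite stq q0.
Qed.

(** The prescribed sources and sinks have the Gelfand-Zeitlin shape: the highest sources, and the
    lowest sinks at each boundary. The flow equation at a boundary then says that thawing the state
    after it gives the state before it. *)
Lemma flow_blocks (R : realType) n K (w : forall j : 'I_K.+1, weighting R (stack n j))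
    (E : seq (cedge (stack n (K := K)))) (fl : state) (hi : nat -> nat) S j :
  flow E (fun l => n <= l + (S - fl 0)) (fun j l => l < hi j + fl j.+1) ->
  (forall i, i <= K -> hi i + fl i.+1 <= n) -> j <= K.+1 ->
  (weight_before w E (j * (n * n).+1) <=
   blocks K.+2 (block_weight w) (fun=> 0%N) hi (@initial R (top_start n K.+2 S)) j
     (flow_state E fl j 0))%E.
Proof.
move=> hE hn; elim: j => [_|j IHj jK] /=.
  rewrite /weight_before big_pred0//; suff -> : flow_state E fl 0 0 = top_sources n K.+2 S (fl 0).
    by rewrite /initial asboolT//; exists (fl 0).
  apply: (@state_split K.+2) => [z zK|l].
    rewrite /flow_state zK /top_sources; case: z zK => [|z] zK //=.
    by rewrite [K.+2 <= _]leqNgt zK.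
  rewrite /top_sources /= leq_addr ltn_add2l /=.
  have [ln|nl] := ltnP l n; last by rewrite flow_state_out.
  rewrite (flow_state_line _ _ _ (Ordinal ln))// (flow_source hE) /=.
  by rewrite [n + _]addnC -addnA leq_add2l.
have {}IHj := IHj (ltnW jK); have jK' : j <= K by [].
have := flow_edge_steps hE jK' (leqnn (n * n)) IHj.
set f := blocks _ _ _ _ _ j => hf.
have hb : (weight_before w E (j.+1 * (n * n).+1) <=
    block K.+2 (block_weight w j) f (flow_state E fl j (n * n)))%E.
  have -> : j.+1 * (n * n).+1 = (j * (n * n).+1 + n * n).+1 by rewrite mulSn addnC addnS.
  rewrite (weight_before_step _ fl (flow_uniq hE) jK' (leqnn _)).
  rewrite [X in (_ + (_ + X))%E]big1 ?adde0; first exact: leeD.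
  by move=> a /eqP am; have := slant_time_lt a; rewrite am ltnn.
apply: (le_trans hb); set X := flow_state E fl j.+1 0; set Y := flow_state E fl j (n * n).
have Xf : X j.+1 = fl j.+1 by rewrite /X /flow_state ltnS jK leqnn.
have bd (l : 'I_n) : Y (K.+2 + l) = X (K.+2 + l) (+) (l < hi j + fl j.+1) /\ ~~ (X (K.+2 + l) && (l < hi j + fl j.+1)).
  rewrite /Y flow_state_line//; have [jK2|] := ltnP j K.
    by rewrite /X flow_state_line//; exact: (flow_boundary hE).
  move=> Kj; have {Kj} ej : j = K by apply/eqP; rewrite eqn_leq jK'.
  have -> : X (K.+2 + l) = false.
    by rewrite /X /flow_state ltnNge leq_addr /= addKn /line_used ej ltnn.
  by rewrite ej (flow_sink hE).
rewrite freezeE ?addn0.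
- suff -> : thaw j.+1 K.+2 (K.+2 + hi j) X = Y by [].
  apply: (@state_split K.+2) => [z zK|l].
    have zp : (z == K.+2 + hi j) = false by rewrite ltn_eqF// (leq_trans zK) ?leq_addr.
    rewrite /thaw zp [K.+2 <= z]leqNgt zK /= /X /Y /flow_state zK.
    have [->|zj] := eqVneq z j.+1; first by rewrite ltnn.
    by rewrite leq_eqVlt (negPf zj).
  rewrite -[X in thaw _ X]addn0 thaw_line// Xf leq0n /=.
  have [ln|nl] := ltnP l n.
    have [h1 h2] := bd (Ordinal ln); move: h1 h2 => /= -> .
    by case: (_ < _); case: (X _).
  rewrite /Y flow_state_out// /X flow_state_out// orbF; apply/negbTE.
  by rewrite -leqNgt; apply: leq_trans nl; apply: hn.
- rewrite Xf; have [ln|nl] := ltnP (hi j) n; last by rewrite /X flow_state_out ?andbF.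
  have [_] := bd (Ordinal ln); rewrite /= -[X in X < _]addn0 ltn_add2l andbC.
  by case: (fl j.+1).
- move=> z z1 z2; rewrite -(subnKC z1) in z2 *; rewrite ltn_add2l in z2.
  have [ln|nl] := ltnP (z - K.+2) n; last by rewrite /X flow_state_out.
  have [_] := bd (Ordinal ln); rewrite /= (leq_trans z2) ?leq_addr// andbT.
  by move/negPf.
Qed.

Lemma weight_before_all (R : realType) n K (w : forall j : 'I_K.+1, weighting R (stack n j))
    (E : seq (cedge (stack n (K := K)))) :
  weight_before w E (K.+1 * (n * n).+1) = (\sum_(c <- E) cweight w c)%E.
Proof.
apply: eq_bigl => c; rewrite /edge_key.
have h1 := tag_le c; have h2 : end_time (tagged c) < (n * n).+1 by rewrite ltnS end_time_le.
apply: (@leq_trans (tag c * (n * n).+1 + (n * n).+1)); first by rewrite ltn_add2l.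
by rewrite addnC -mulSn leq_mul2r ltnS h1 orbT.
Qed.

Lemma flow_weight_le_blocks (R : realType) n K (w : forall j : 'I_K.+1, weighting R (stack n j))
    (E : seq (cedge (stack n (K := K)))) (fl : state) (hi : nat -> nat) S :
  flow E (fun l => n <= l + (S - fl 0)) (fun j l => l < hi j + fl j.+1) ->
  (forall i, i <= K -> hi i + fl i.+1 <= n) ->
  (\sum_(c <- E) cweight w c <=
   blocks K.+2 (block_weight w) (fun=> 0%N) hi (@initial R (top_start n K.+2 S)) K.+1
     (fun z => (z < K.+2)%N && fl z))%E.
Proof.
move=> hE hn; have := flow_blocks w hE hn (leqnn _); rewrite weight_before_all.
suff -> : flow_state E fl K.+1 0 = (fun z => (z < K.+2) && fl z) by [].
apply: funext => z; rewrite /flow_state; case: ltnP => //= [zK|_]; last by rewrite /line_used ltnn.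
by rewrite -ltnS zK.
Qed.

(** * The octahedron relation *)

(** One inequality follows the flow of an optimal multipath provided by the condition; the other
    holds for any weighting. The flag 0 reduces the number of paths from [S] to [S - 1]. *)
Lemma GZ_max_weight (R : realType) n K (w : forall j : 'I_K.+1, weighting R (stack n j))
    (alpha : 'I_K.+1 -> nat) (fl : state) (hi : nat -> nat) S :
  multi_Gelfand_Zeitlin w -> (forall b : 'I_K.+1, alpha b = hi b + fl b.+1) ->
  \sum_(b < K.+1) alpha b = S - fl 0 -> S - fl 0 <= n ->
  max_weight w alpha =
  blocks K.+2 (block_weight w) (fun=> 0) hi (@initial R (top_start n K.+2 S)) K.+1
     (fun z => (z < K.+2) && fl z).
Proof.
move=> gz ha hS hn.
have an (b : 'I_K.+1) : alpha b <= n.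
  by rewrite -hS in hn; apply: leq_trans hn; rewrite (bigD1 b)//= leq_addr.
have hin i : i <= K -> hi i + fl i.+1 <= n.
  by move=> iK; have := an (inord i); rewrite ha inordK.
apply/eqP; rewrite eq_le; apply/andP; split.
  have [|p [mp <- psrc psnk]] := gz alpha; first by rewrite hS.
  rewrite multipath_weightE; apply: flow_weight_le_blocks hin => //.
  apply: (multipath_flow mp) => [s|i t].
    by rewrite psrc hS leq_subLR addnC.
  by rewrite psnk ha.
apply: blocks_le_max_weight => //.
- move=> b; have -> : (b.+1 < K.+2) && fl b.+1 = fl b.+1 by rewrite ltnS ltn_ord.
  by split; [apply: hin; rewrite -ltnS | rewrite subn0].
- by move=> l; rewrite ltnNge leq_addr.
Qed.

(** * Finiteness of the maximal weights *)

Lemma adde_neq_pinfty (R : realType) (x y : \bar R) :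
  x != +oo%E -> y != +oo%E -> (x + y != +oo)%E.
Proof. by case: x; case: y. Qed.

Lemma multipath_weight_neq_pinfty (R : realType) n k (N : 'I_k -> network n)
    (w : forall j, weighting R (N j)) p : multipath_weight w p != +oo%E.
Proof.
apply: (big_ind (fun x => x != +oo%E)) => //; first exact: adde_neq_pinfty.
move=> i _; apply: (big_ind (fun x => x != +oo%E)) => //; first exact: adde_neq_pinfty.
move=> x _; apply: (big_ind (fun x => x != +oo%E)) => //; first exact: adde_neq_pinfty.
by move=> e _; rewrite /cweight; case: (w _ _).
Qed.

(* The lower end of a slanted edge lies on a line that is already occupied, so no
   slanted edge is used. *)
Lemma full_flow n K (E : seq (cedge (stack n (K := K)))) (src : pred 'I_n)
    (snk : nat -> pred 'I_n) j m l :
  flow E src snk -> (forall l, src l) -> (forall i l, i < K -> ~~ snk i l) ->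
  j <= K -> m <= n * n -> at_block K j (segment m l) \in E.
Proof.
move=> hE hsrc hsnk.
have step i : i <= K -> (forall l, at_block K i (segment 0 l) \in E) ->
    forall m, m <= n * n -> forall l, at_block K i (segment m l) \in E.
  move=> iK h0; elim=> [|k IHk] kn l0; first exact: h0.
  have {}IHk := IHk (ltnW kn); have [e|ne] := eqVneq (end_time (segment k l0)) k; last first.
    by rewrite segment_stay.
  have [p [pl pt _]] := end_time_point_exists kn e.
  have [s1 _] := flow_start hE (point_edge p) iK; have [e1 e2] := flow_end hE (point_edge p) iK.
  rewrite -[slant_time _]/(point_time p) pt !IHk in s1 e1 e2.
  have d0 : (at_block K i (inl (point_edge p)) \in E) = false by apply: negbTE.
  rewrite d0 addbF in s1; rewrite d0 in e1.
  by rewrite -pl; case: p s1 e1 {pl pt e2 d0} => a /= s1 e1; [rewrite -s1 | rewrite e1].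
move=> jK; move: m l; elim: j jK => [|j IHj] jK m l mn.
  by apply: step => // l'; rewrite (flow_source hE).
apply: step => // l'; have := IHj (ltnW jK) (n * n) l' (leqnn _).
have [-> _] := flow_boundary hE l' jK.
by rewrite (negPf (hsnk _ _ jK)) addbF.
Qed.

(** The witness is a family that never leaves the horizontal lines, so only their weights matter. *)
Lemma max_weight_neq_ninfty (R : realType) n K (w : forall j : 'I_K.+1, weighting R (stack n j))
    (alpha : 'I_K.+1 -> nat) :
  (forall j m l, j <= K -> m <= n * n -> block_weight w j (segment m l) != -oo%E) ->
  \sum_(b < K.+1) alpha b <= n -> max_weight w alpha != -oo%E.
Proof.
(* The paths of network index [b] follow the lines from [c b] to [c b.+1] excluded, so the lowest
   remaining paths are always the next to stop. *)
move=> fin hn; pose c m := \sum_(b < m) alpha (inord b).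
have cS m : c m.+1 = c m + alpha (inord m) by rewrite /c big_ord_recr.
have cK : c K.+1 = \sum_(b < K.+1) alpha b by apply: eq_bigr => b _; rewrite inord_val.
have cle : {homo c : i j / i <= j}.
  by apply: homo_leq => //; [apply: leq_trans | move=> m; rewrite cS leq_addr].
(* The lines still occupied after [j] boundaries. All flags stay down, since [hi] already accounts
   for every path that stops. *)
pose X (j : nat) : state := fun z => (K.+2 <= z) && (c j <= z - K.+2 < c K.+1).
have Xl j l : X j (K.+2 + l) = (c j <= l < c K.+1) by rewrite /X leq_addr addKn.
have Xs j z : z < K.+2 -> X j z = false by rewrite /X ltnNge => /negPf->.
have addN u f Z : (forall l : 'I_n, u l != -oo%E) -> f Z != -oo%E ->
    @add_weights R n K.+2 u f Z != -oo%E.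
  move=> hu hf; rewrite /add_weights adde_eq_ninfty negb_or hf /=.
  apply/eqP => /esum_eqNyP[l [_ _]]; case: (Z _) => // /eqP.
  by rewrite (negPf (hu l)).
have segN j m : j <= K -> m <= n * n -> forall l, segment_weight (block_weight w j) m l != -oo%E.
  by move=> jK mn l; rewrite /segment_weight; case: ifP => // _; apply: fin.
have stepsN j f Z m : j <= K -> m <= n * n -> f Z != -oo%E ->
    edge_steps K.+2 (block_weight w j) f m Z != -oo%E.
  move=> jK + hf; elim: m => //= m IHm mn; rewrite /edge_step; set g := add_weights _ _ _.
  have gN : g Z != -oo%E by apply: addN; [apply: segN => //; apply: ltnW | apply/IHm/ltnW].
  case: pickP => // a _; apply: contra gN => /eqP e.
  by rewrite -leeNy_eq -e step_down_stay.
have bN j : j <= K.+1 ->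
    blocks K.+2 (block_weight w) c (fun i => c i.+1) (@initial R (fun Z => Z = X 0)) j (X j) != -oo%E.
  elim: j => [_|j IHj jK] /=; first by rewrite /initial asboolT.
  rewrite freezeE.
  - suff -> : thaw j.+1 (K.+2 + c j) (K.+2 + c j.+1) (X j.+1) = X j.
      by apply: addN; [apply: segN | apply: stepsN => //; apply: IHj; apply: ltnW].
    apply: (@state_split K.+2) => [z zK|l].
      have zp : (z == K.+2 + c j.+1) = false by rewrite ltn_eqF// (leq_trans zK) ?leq_addr.
      rewrite /thaw zp leqNgt (leq_trans zK) ?leq_addr//= !Xs//.
      by case: ifP.
    rewrite thaw_line//; last by rewrite cle.
    rewrite [X j.+1 j.+1]Xs ?ltnS// addn0 !Xl.
    by have := cle _ _ (leqnSn j); have := cle _ _ jK; clear; lia.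
  - by rewrite Xs ?ltnS.
  move=> z z1 z2; have zK : K.+2 <= z by apply: leq_trans z1; rewrite leq_addr.
  by move: z2; rewrite -(subnKC zK) ltn_add2l Xl => z2; rewrite leqNgt z2.
have := bN K.+1 (leqnn _); apply: contraNN => /eqP e; rewrite -leeNy_eq -e.
apply: blocks_le_max_weight.
- by move=> i; rewrite cle.
- move=> b; have -> : X K.+1 b.+1 = false by rewrite Xs// ltnS ltn_ord.
  rewrite addn0; split; last by rewrite cS inord_val addKn.
  by rewrite (leq_trans _ hn)// -cK cle.
- by move=> l; rewrite Xl; case: leqP.
Qed.

(** The sum of all [n] singular values is real, so an optimal [n]-multipath has weight other than
    -oo. It runs along every horizontal segment, hence none of these has weight -oo. *)
Lemma GZ_finite (R : realType) n K (w : forall j : 'I_K.+1, weighting R (stack n j))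
    (alpha : 'I_K.+1 -> nat) :
  real_GZ w -> \sum_(b < K.+1) alpha b <= n -> max_weight w alpha \is a fin_num.
Proof.
move=> [[lambda hl] gz] ha; rewrite fin_numE; apply/andP; split; last first.
  by have [p [_ <- _ _]] := gz _ ha; apply: multipath_weight_neq_pinfty.
apply: max_weight_neq_ninfty ha => j m l jK mn.
pose top := @only_last K.+1 n.
have topE (i : 'I_K.+1) : top i = if i == ord_max then n else 0.
  by rewrite /top /only_last eqSS.
have stop : \sum_(i < K.+1) top i = n.
  by rewrite (bigD1 ord_max)//= big1 => [|i /negPf ne]; rewrite topE ?ne// eqxx addn0.
have [|p [mp ep psrc psnk]] := gz top; first by rewrite stop.
have topN : (\sum_(c <- multipath_edges p) cweight w c != -oo)%E.
  rewrite -multipath_weightE ep -(hl n (leqnn n)).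
  by apply/eqP => /esum_eqNyP[i [_ _]].
have fl : flow (multipath_edges p) predT (fun i l => (i == K) && (l < n)).
  apply: (multipath_flow mp) => [s|i t]; first by rewrite psrc stop subnn.
  by rewrite psnk topE /= -val_eqE /=; case: (_ == _).
have inE' := full_flow l fl (fun=> isT) _ jK mn.
apply: contra topN => /eqP hj; apply/eqP/esum_eqNyP; exists (at_block K j (segment m l)).
by split=> //; apply: inE' => i l' iK; rewrite /= ltn_eqF.
Qed.

(** * The function m on the four flags *)

Lemma unset_top_start (R : realType) n off S :
  unset 1 off (@initial R (top_start n off S)).
Proof.
move=> X /initialP[[e ->] _] z z1 zo; rewrite /top_sources gtn_eqF//.
by rewrite leqNgt zo.
Qed.

(** With [S = i + j + k + 2], there are [S - e0] paths exactly when the four flags sum to 2. The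
    number 4 is the position of the first line in a composite of three networks. *)
Lemma mfun_flags (R : realType) n (w1 w2 w3 : weighting R (standard n)) i j k
    (e0 e1 e2 e3 : bool) :
  admissible w1 w2 w3 -> i + j + k + 2 <= n -> e0 + e1 + e2 + e3 = 2 ->
  mfun w1 w2 w3 (i + e1) (j + e2) (k + e3) =
  blocks 4 (block_weight (K := 2) (comp3 w1 w2 w3)) (fun=> 0) (nth 0 [:: i; j; k])
    (@initial R (top_start n 4 (i + j + k + 2))) 3 (flags e0 e1 e2 e3).
Proof.
move=> [_ _ _ _ [_ gz]] hn he.
have -> : flags e0 e1 e2 e3 = (fun z => (z < 4) && flags e0 e1 e2 e3 z).
  by apply: funext => -[|[|[|[|z]]]] //=; rewrite /flags nth_default.
apply: (@GZ_max_weight R n 2 _ _ (flags e0 e1 e2 e3) (nth 0 [:: i; j; k])) => //.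
- by move=> -[[|[|[|//]]] h].
- rewrite !big_ord_recl big_ord0 /=.
  rewrite !(tnth_nth 0) /= /flags /=; move: he; clear; lia.
- rewrite /flags /=; lia.
Qed.

Lemma mfun_octahedron (R : realType) n (w1 w2 w3 : weighting R (standard n)) i j k :
  admissible w1 w2 w3 -> i + j + k + 2 <= n ->
  (mfun w1 w2 w3 i j.+1 k + mfun w1 w2 w3 i.+1 j k.+1 =
   maxe (mfun w1 w2 w3 i.+1 j k + mfun w1 w2 w3 i j.+1 k.+1)
        (mfun w1 w2 w3 i.+1 j.+1 k + mfun w1 w2 w3 i j k.+1))%E.
Proof.
move=> hw hn; pose F := blocks 4 (block_weight (K := 2) (comp3 w1 w2 w3)) (fun=> 0)
  (nth 0 [:: i; j; k]) (@initial R (top_start n 4 (i + j + k + 2))) 3.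
have mE e0 e1 e2 e3 := @mfun_flags R n w1 w2 w3 i j k e0 e1 e2 e3 hw hn.
have exF : exchangeable F.
  have ex0 : exchangeable (@initial R (top_start n 4 (i + j + k + 2))).
    by apply: exchangeable_top_start; rewrite ?hn ?andbT ?addn2.
  have := exchangeable_blocks (block_weight (K := 2) (comp3 w1 w2 w3)) (nth 0 [:: i; j; k])
    (isT : 3 < 4) (@unset_top_start R n 4 _) ex0.
  by case.
have := octahedron exF; rewrite /F -!mE// !addn0 !addn1.
by [].
Qed.

Lemma mfun_fin_num (R : realType) n (w1 w2 w3 : weighting R (standard n)) i j k :
  admissible w1 w2 w3 -> i + j + k <= n -> mfun w1 w2 w3 i j k \is a fin_num.
Proof.
move=> [_ _ _ _ gz] hn; apply: (@GZ_finite R n 2) => //.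
by rewrite !big_ord_recl big_ord0 /= !(tnth_nth 0) /= addn0 addnA.
Qed.

(** Cancellation, which would fail at -oo; it is what turns the relation into a formula for one of
    its terms. *)
Lemma adde_fin_inj (R : realType) (a b x y : \bar R) :
  a \is a fin_num -> b \is a fin_num -> x \is a fin_num -> y \is a fin_num ->
  a = b -> (a + x = b + y)%E -> x = y.
Proof. by case: a b x y => [a||] [b||] [x||] [y||] // _ _ _ _ [->] [] /addrI->. Qed.

Theorem theorem2p7 (R : realType) (n : nat) :
  (forall w1 w2 w3 : weighting R (standard n), admissible w1 w2 w3 ->
     forall i j k : nat, (i + j + k + 2 <= n)%N ->
       (mfun w1 w2 w3 i j.+1 k + mfun w1 w2 w3 i.+1 j k.+1 =
        maxe (mfun w1 w2 w3 i.+1 j k + mfun w1 w2 w3 i j.+1 k.+1)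
             (mfun w1 w2 w3 i.+1 j.+1 k + mfun w1 w2 w3 i j k.+1))%E)
  /\
  (forall w1 w2 w3 v1 v2 v3 : weighting R (standard n),
     admissible w1 w2 w3 -> admissible v1 v2 v3 ->
     (forall i j k : nat, (i + j + k <= n)%N -> k = 0%N \/ i = 0%N ->
        mfun w1 w2 w3 i j k = mfun v1 v2 v3 i j k) ->
     forall i j k : nat, (i + j + k <= n)%N ->
        mfun w1 w2 w3 i j k = mfun v1 v2 v3 i j k)
  /\
  (forall w1 w2 w3 v1 v2 v3 : weighting R (standard n),
     admissible w1 w2 w3 -> admissible v1 v2 v3 ->
     (forall i j k : nat, (i + j + k <= n)%N -> (i + j + k)%N = n \/ j = 0%N ->
        mfun w1 w2 w3 i j k = mfun v1 v2 v3 i j k) ->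
     forall i j k : nat, (i + j + k <= n)%N ->
        mfun w1 w2 w3 i j k = mfun v1 v2 v3 i j k).
Proof.
split; first by move=> w1 w2 w3 hw i j k; apply: mfun_octahedron.
split=> w1 w2 w3 v1 v2 v3 hw hv hm i j k.
  (* The relation is solved for the value at [(i + 1, j, k + 1)]; the sum of the first and third
     indices is smaller in the five other terms. *)
  have [s] := ubnP (i + k); elim: s i j k => // s IHs [|i] j [|k] hs hn; try by apply: hm; auto.
  have fw := mfun_fin_num hw; have fv := mfun_fin_num hv.
  have hn' : i + j + k + 2 <= n by lia.
  have := mfun_octahedron hw hn'; rewrite [in RHS]IHs; try lia.
  rewrite [mfun w1 w2 w3 i j.+1 k.+1]IHs ?[mfun w1 w2 w3 i.+1 j.+1 k]IHs
    ?[mfun w1 w2 w3 i j k.+1]IHs; try lia.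
  rewrite -(mfun_octahedron hv hn'); apply: adde_fin_inj.
  all: try (apply: fw; lia); try (apply: fv; lia).
  by apply: IHs; lia.
(* The relation is now solved for the value at [(i, j + 1, k)]. In the five other terms the middle
   index is smaller or the total is larger, and [n - (i + j + k) + j] decreases in each of them. *)
have [s] := ubnP (n - (i + j + k) + j); elim: s i j k => // s IHs i [|j] k hs hn.
  by apply: hm; auto.
have [e|ne] := eqVneq (i + j.+1 + k) n; first by apply: hm; auto.
have fw := mfun_fin_num hw; have fv := mfun_fin_num hv.
have hn' : i + j + k + 2 <= n by lia.
have := mfun_octahedron hw hn'; rewrite [in RHS]IHs; try lia.
rewrite [mfun w1 w2 w3 i j.+1 k.+1]IHs ?[mfun w1 w2 w3 i.+1 j.+1 k]IHs
  ?[mfun w1 w2 w3 i j k.+1]IHs; try lia.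
rewrite -(mfun_octahedron hv hn') addeC [RHS]addeC; apply: adde_fin_inj.
all: try (apply: fw; lia); try (apply: fv; lia).
by apply: IHs; lia.
Qed.
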